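(* Let $K$ be a positive definite (pd) kernel on a non-empty set $X$. (I) If $K$ has a pdms root and $A$ is a non-empty subset of $X$, then $K|_{A\times A}$ has a pdms root as well. (II) If $K=\bigoplus_{s\in S}K_s$, then $K$ has a pdms root iff each of $K_s$ has a pdms root. (III) If $K$ has a pdms root and $u\colon X\to\mathbb C$ is a bounded function, then the kernel $L\colon X\times X\ni(x,y)\mapsto\overline{u(x)}u(y)K(x,y)\in\mathbb C$ has a pdms root as well. In particular, the kernel $$K_{\mathrm{bd}}\colon X\times X\ni(x,y)\mapsto\frac{K(x,y)}{\sqrt{\max(K(x,x),1)\cdot\max(K(y,y),1)}}\in\mathbb C$$ has a pdms root provided $K$ has one. (IV) If $K$ is bounded and has a pdms root, then for any $x\in X$, $K(x,\cdot)$ is a $c_0$-function; that is, for any $x\in X$ and $\varepsilon>0$ there is a finite set $F\subset X$ such that $|K(x,y)|<\varepsilon$ for any $y\notin F$. (V) If $K$ is an $\ell_2$-kernel, it has a pdms root. In particular, each pdms root of a pd kernel has a pdms root. (VI) If $K=\sum_{s\in S}K_s$ where $\{K_s\}_{s\in S}$ is an arbitrary family of pd kernels (on $X$) having pdms roots, then $K$ also has a pdms root. (VII) If $K$ is the pointwise limit of an increasing net of pd kernels on $X$ each of which has a pdms root, then also $K$ has a pdms root. (VIII) If $L$ is a pd kernel on $X$ such that $c_1K\ll L\ll c_2K$ for some positive constants $c_1$ and $c_2$, then either both $K$ and $L$ have pdms roots or none of them. (IX) There exists a unique pd kernel $K_0\ll K$ that has a pdms root and is the greatest kernel with these properties; that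 is, if $L\ll K$ is a pd kernel that has a pdms root, then $L\ll K_0$. (X) There exists a pd kernel $K_1\ll K$ that has a unique pdms root and the following property: whenever $L$ is a pd kernel on $X$ such that $L\ll aK$ for some constant $a>0$, then $L$ has a unique pdms root iff $L\ll bK_1$ for some constant $b>0$.
   Context: A kernel on $X$ is a function $K\colon X\times X\to\mathbb C$; it is positive definite (pd) if $\sum_{j,k=1}^n\lambda_j\overline{\lambda_k}K(x_j,x_k)\ge0$ for all $n\ge1$, $x_j\in X$, $\lambda_j\in\mathbb C$. For kernels $K,L$ on $X$, $K\ll L$ means that $L-K$ is pd. A kernel $K$ is an $\ell_2$-kernel if $K(x,\cdot),K(\cdot,x)\in\ell_2(X)$ for all $x\in X$. A pd kernel $M$ on $X$ is a pdms root (positive definite matrix-type square root) of a pd kernel $L$ on $X$ if $L(x,z)=\sum_{y\in X}M(x,y)M(y,z)$ for all $x,z\in X$; ''has a unique pdms root'' means exactly one such $M$ exists. If $X$ is the disjoint union of sets $X_s$ ($s\in S$) and $K_s$ is a kernel on $X_s$, then $\bigoplus_{s\in S}K_s$ is the kernel on $X$ equal to $K_t(x,y)$ for $x,y\in X_t$ and to $0$ if $x,y$ lie in different sets $X_s$ (it is pd iff all $K_s$ are). In (VI) the sum is understood pointwise: $K(x,y)=\sum_{s\in S}K_s(x,y)$ for all $x,y\in X$ (unordered sums; they converge absolutely iff $\sum_{s}K_s(x,x)<\infty$ for all $x$). In (VII) an increasing net is a family $\{K_\sigma\}_{\sigma\in\Sigma}$ of pd kernels on $X$ indexed by a directed set $(\Sigma,\le)$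 with $K_\sigma\ll K_\tau$ whenever $\sigma\le\tau$; $K$ is its pointwise limit if $K(x,y)=\lim_{\sigma}K_\sigma(x,y)$ for all $x,y\in X$. *)

(* Defs.v *)
From HB Require Import structures.
From mathcomp Require Import all_boot all_order all_algebra finmap.
From mathcomp Require Import all_classical all_reals all_analysis.
From mathcomp Require Import complex.
From mathcomp.analysis.showcase Require summability.

Set Implicit Arguments.
Unset Strict Implicit.
Unset Printing Implicit Defensive.

Import Order.TTheory GRing.Theory Num.Theory.
Import numFieldNormedType.Exports.

Local Open Scope classical_set_scope.
Local Open Scope complex_scope.
Local Open Scope ring_scope.

Definition ckernel (R : realType) (X : Type) := X -> X -> R[i].

Section Kernels.
Variable R : realType.

(* The order of [R[i]] is partial: [0 <= z] means that [z] is real and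
   nonnegative. *)
Definition posdef (X : Type) (K : ckernel R X) : Prop :=
  forall (n : nat) (x : 'I_n -> X) (lambda : 'I_n -> R[i]), (0 < n)%N ->
    0 <= \sum_(j < n) \sum_(k < n) lambda j * (lambda k)^* * K (x j) (x k).

Definition kle (X : Type) (K L : ckernel R X) : Prop :=
  posdef (fun x y => L x y - K x y).

Definition kscale (X : Type) (a : R) (K : ckernel R X) : ckernel R X :=
  fun x y => a%:C * K x y.

Definition krestrict (X : Type) (A : set X) (K : ckernel R X) : ckernel R A :=
  fun x y => K (val x) (val y).

Definition kbounded (X : Type) (K : ckernel R X) : Prop :=
  exists c : R, forall x y, `|K x y| <= c%:C.

(* The kernel [K_bd]; [K x x] is real and nonnegative when [K] is positive
   definite, so the maxima are taken between comparable elements and [sqrtC] is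
   the usual square root. *)
Definition kbd (X : Type) (K : ckernel R X) : ckernel R X :=
  fun x y => K x y / sqrtC (Num.max (K x x) 1 * Num.max (K y y) 1).

(* [X_ s], for [s : S], is a partition of [X] (empty blocks are allowed) and
   [K] is the direct sum of the kernels [K_ s]. *)
Definition is_direct_sum (X S : Type) (X_ : S -> set X)
    (K_ : forall s, ckernel R (X_ s)) (K : ckernel R X) : Prop :=
  [/\ trivIset setT X_,
      \bigcup_s X_ s = setT,
      forall s (x y : X_ s), K (val x) (val y) = K_ s x y &
      forall s t (x : X_ s) (y : X_ t), s <> t -> K (val x) (val y) = 0].

(* Unordered sums: convergence of the net of the sums over finite subsets. *)
Definition has_sum (I : choiceType) (f : I -> R[i]) (l : R[i]) : Prop :=
  summability.partial_sum f @ summability.totally --> (l : R[i]^o).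

Definition l2_fun (X : choiceType) (f : X -> R[i]) : Prop :=
  (\esum_(x in [set: X]) (complex.Re `|f x| ^+ 2)%:E < +oo)%E.

Definition l2_kernel (X : choiceType) (K : ckernel R X) : Prop :=
  forall x, l2_fun (K x) /\ l2_fun (fun y => K y x).

Definition is_pdms_root (X : choiceType) (L M : ckernel R X) : Prop :=
  [/\ posdef L, posdef M &
      forall x z, has_sum (fun y => M x y * M y z) (L x z)].

Definition has_pdms_root (X : choiceType) (L : ckernel R X) : Prop :=
  exists M, is_pdms_root L M.

Definition has_unique_pdms_root (X : choiceType) (L : ckernel R X) : Prop :=
  exists! M, is_pdms_root L M.

End Kernels.
Arguments krestrict {R X} A K _ _.

Definition directed (I : Type) (le : I -> I -> Prop) : Prop :=
  [/\ inhabited I,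
      forall i, le i i,
      forall i j k, le i j -> le j k -> le i k &
      forall i j, exists2 k, le i k & le j k].

Definition tails (I : Type) (le : I -> I -> Prop) : set_system I :=
  filter_from setT (fun i => [set j | le i j]).

Definition kernel_net_cvg (R : realType) (X I : Type) (le : I -> I -> Prop)
    (K_ : I -> ckernel R X) (K : ckernel R X) : Prop :=
  forall x y, (fun i => K_ i x y) @ tails le --> (K x y : R[i]^o).

(* Main.v *)
Require Import Defs.
From HB Require Import structures.
From mathcomp Require Import all_boot all_order all_algebra finmap.
From mathcomp Require Import all_classical all_reals all_analysis.
From mathcomp Require Import complex.
From mathcomp Require Import ring lra.
From mathcomp.analysis.showcase Require summability.

(** Write [w s] for the finitely supported function given by a finite sequence
    [s] of weighted points, and [L s] for the value on it of the quadratic form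
    of the kernel [L].  A root [M] of [L] is a positive symmetric operator in
    [l2(X)], defined on the finitely supported functions, with
    [L s = |M (w s)| ^ 2].  The whole theorem rests on one criterion,
    [has_root_lsc]: a positive definite [L] has a root if and only if its form
    is closable in [l2(X)], that is, lower semicontinuous for the norm of [l2]
    on finitely supported functions.

    If [L] has a root then [L t] is the supremum over [h] of
    [2 Re <w t, M (w h)> - |w h| ^ 2], and each of these functions of [w t] is
    continuous.  Conversely, let [T] be the operator of a closable form; its
    square root is a root of [L].  To avoid unbounded operators, the proof of
    [greatest_regular_part] works with the bounded operators [(1 + T) ^ -1],
    which comes from approximate Riesz representation for the form
    [L s + |w s| ^ 2], and [T ^ (1/2) (1 + T) ^ -1], a square root of a bounded
    positive operator; a Neumann series then undoes the factor [(1 + T) ^ -1].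
    For an arbitrary nonnegative form the same construction yields the largest
    closable minorant; it gives the greatest kernel below [K] that has a root,
    and it equals the form when the form is closable.

    Most of the other existence results are then permanence properties of
    closable forms: pullbacks along injective partial maps with bounded weights,
    suprema of increasing families, and passage to equivalent forms.  For a
    kernel with square-summable rows, the form is a supremum of the continuous
    functions [2 Re K (t, s) - K s].  That the rows of a bounded kernel with a
    root vanish at infinity follows by approximating the rows of the root by
    finitely supported functions.

    A root of [L] is unique if and only if [L] is bounded, that is, dominated
    by a multiple of the identity kernel.  A bounded positive
    operator has only one positive square root ([unique_square_root]).  If the
    root [M] is unbounded, the uniform boundedness principle provides a vector
    [xi] for which [h |-> <xi, M h>] is unbounded.  The form of [L] can then be
    extended to a closable form on the finitely supported functions together
    with [xi], and the square root of the extension restricts to a root for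
    which the corresponding functional is bounded ([extended_root]).  The
    kernel [K1] is the parallel sum of [K] and of the identity kernel, which up
    to a factor is the largest kernel dominated by both. *)

Set Implicit Arguments.
Unset Strict Implicit.
Unset Printing Implicit Defensive.

Import Order.TTheory GRing.Theory Num.Theory.
Import numFieldNormedType.Exports Normc.

Local Open Scope classical_set_scope.
Local Open Scope complex_scope.
Local Open Scope ring_scope.

Local Notation re := complex.Re.
Local Notation im := complex.Im.

(** * Complex numbers *)

Section ComplexNumbers.
Variable R : realType.
Implicit Types (x y z : R[i]) (a b r : R).

Lemma reD x y : re (x + y) = re x + re y. Proof. by case: x; case: y. Qed.
Lemma reN x : re (- x) = - re x. Proof. by case: x. Qed.
Lemma reB x y : re (x - y) = re x - re y. Proof. by rewrite reD reN. Qed.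
Lemma reM x y : re (x * y) = re x * re y - im x * im y.
Proof. by case: x; case: y. Qed.
Lemma imD x y : im (x + y) = im x + im y. Proof. by case: x; case: y. Qed.
Lemma imN x : im (- x) = - im x. Proof. by case: x. Qed.
Lemma imM x y : im (x * y) = re x * im y + im x * re y.
Proof. by case: x; case: y. Qed.
Lemma conj_real r : (r%:C : R[i])^* = r%:C.
Proof. exact: conjc_real. Qed.
Lemma reJ x : re x^* = re x. Proof. by case: x. Qed.
Lemma imJ x : im x^* = - im x. Proof. by case: x. Qed.
Lemma reZ r x : re (r%:C * x) = r * re x.
Proof. by rewrite reM /= mul0r subr0. Qed.
Lemma re_sum (I : Type) (s : seq I) (P : pred I) (F : I -> R[i]) :
  re (\sum_(i <- s | P i) F i) = \sum_(i <- s | P i) re (F i).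
Proof. exact: (big_morph _ reD). Qed.
Lemma complex_ext x y : re x = re y -> im x = im y -> x = y.
Proof. by case: x => a b; case: y => c d /= -> ->. Qed.
Lemma ge0_complexE x : (0 <= x) = (im x == 0) && (0 <= re x).
Proof. by rewrite lecE. Qed.
Lemma ge0_complexP x : 0 <= x -> x = (re x)%:C.
Proof. by rewrite ge0_complexE => /andP[/eqP h _]; apply: complex_ext. Qed.

Lemma absE x : `|x| = (normc x)%:C. Proof. by []. Qed.
Lemma normc2E x : normc x ^+ 2 = re x ^+ 2 + im x ^+ 2.
Proof. by case: x => a b /=; rewrite sqr_sqrtr // addr_ge0 // sqr_ge0. Qed.
Lemma normc_ge0 x : 0 <= normc x.
Proof. by case: x => a b; exact: sqrtr_ge0. Qed.
Lemma normc_conj x : normc x^* = normc x.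
Proof. by case: x => a b /=; rewrite sqrrN. Qed.
Lemma abs_re_le_normc x : `|re x| <= normc x.
Proof. by rewrite -lecR; exact: normc_ge_Re. Qed.
Lemma abs_im_le_normc x : `|im x| <= normc x.
Proof.
rewrite -(@ler_pXn2r _ 2) ?nnegrE ?normc_ge0 // normc2E real_normK ?num_real //.
by rewrite lerDr sqr_ge0.
Qed.
Lemma re_le_normc x : re x <= normc x.
Proof. exact: le_trans (ler_norm _) (abs_re_le_normc x). Qed.
Lemma normc_real a : normc (a%:C) = `|a|.
Proof. by rewrite /= expr0n addr0 sqrtr_sqr. Qed.
Lemma mul_conj x : x * x^* = (normc x ^+ 2)%:C.
Proof.
rewrite normc2E; apply: complex_ext.
  by rewrite reM reJ imJ /=; ring.
by rewrite imM reJ imJ /=; ring.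
Qed.
Lemma normc_eq0 x : (normc x == 0) = (x == 0).
Proof. by apply/eqP/eqP => [/eq0_normc//|->]; rewrite normc0. Qed.

Lemma eq_of_normc_small x y : (forall e, 0 < e -> normc (x - y) <= e) -> x = y.
Proof.
move=> h; apply/eqP; rewrite -subr_eq0 -normc_eq0; apply/eqP/le_anti.
rewrite normc_ge0 andbT; apply/ler_addgt0Pr => e e0; rewrite add0r; exact: h.
Qed.

(** The common core of the Cauchy-Schwarz inequality, for vectors and for
    kernels, and of its approximate version for almost optimal vectors. *)
Lemma discriminant_le a b z : 0 <= b ->
  (forall c : R[i], 0 <= a + 2 * re (c * z) + normc c ^+ 2 * b) ->
  normc z ^+ 2 <= a * b.
Proof.
move=> b0 h.
set n := normc z ^+ 2.
have {}h t : 0 <= a + 2 * t * n + t ^+ 2 * n * b.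
  have := h (t%:C * z^*); rewrite normcM normc_real normc_conj exprMn real_normK ?num_real //.
  have -> : t%:C * z^* * z = t%:C * n%:C by rewrite -mulrA [z^* * z]mulrC mul_conj.
  by rewrite reZ mulrA.
have n0 : 0 <= n by rewrite sqr_ge0.
have a0 : 0 <= a by have := h 0; lra.
have [b00|bn0] := eqVneq b 0; last first.
  have {}b0 : 0 < b by rewrite lt_def bn0.
  have := h (- b^-1); rewrite -(ler_pM2r b0) mul0r.
  suff -> : (a + 2 * - b^-1 * n + (- b^-1) ^+ 2 * n * b) * b = a * b - n by lra.
  by field; lra.
rewrite b00 mulr0 leNgt; apply/negP => np.
have := h (- (a + 1) / n); rewrite b00 mulr0 addr0.
suff -> : a + 2 * (- (a + 1) / n) * n = - a - 2 by lra.
by field; lra.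
Qed.

End ComplexNumbers.

(** * Hilbert spaces *)

Record hilbert (R : realType) := Hilbert {
  hsort :> lmodType R[i];
  dot : hsort -> hsort -> R[i];
  dotDl : forall u v w, dot (u + v) w = dot u w + dot v w;
  dotZl : forall a u w, dot (a *: u) w = a * dot u w;
  dotC : forall u v, dot v u = (dot u v)^*;
  dot_ge0 : forall u, 0 <= re (dot u u);
  dot_eq0 : forall u, re (dot u u) = 0 -> u = 0;
  hilbert_complete : forall u : nat -> hsort,
    (forall e : R, 0 < e -> exists N, forall m n, (N <= m)%N -> (N <= n)%N ->
       re (dot (u m - u n) (u m - u n)) < e) ->
    exists l, forall e : R, 0 < e -> exists N, forall n, (N <= n)%N ->
       re (dot (u n - l) (u n - l)) < e }.

Arguments dot : simpl never.

Section Hilbert.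
Variables (R : realType) (H : hilbert R).
Implicit Types (u v w : H) (a b : R[i]).

Definition nrm u : R := Num.sqrt (re (dot u u)).

Lemma re_mul_ext (x y : R[i]) : (forall c, re (c * x) = re (c * y)) -> x = y.
Proof.
move=> h; have := h 1; have := h 'i%C; rewrite !mul1r !reM /= => h2 h1.
by apply: complex_ext => //; lra.
Qed.

Lemma dotDr u v w : dot u (v + w) = dot u v + dot u w.
Proof. by rewrite dotC dotDl rmorphD /= -!dotC. Qed.
Lemma dotZr a u v : dot u (a *: v) = a^* * dot u v.
Proof. by rewrite dotC dotZl rmorphM /= -dotC. Qed.
Lemma dot0l u : dot 0 u = 0.
Proof. by rewrite -(scale0r u) dotZl mul0r. Qed.
Lemma dot0r u : dot u 0 = 0.
Proof. by rewrite dotC dot0l rmorph0. Qed.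
Lemma dotNl u v : dot (- u) v = - dot u v.
Proof. by rewrite -scaleN1r dotZl mulN1r. Qed.
Lemma dotNr u v : dot u (- v) = - dot u v.
Proof. by rewrite dotC dotNl rmorphN /= -dotC. Qed.
Lemma dotBl u v w : dot (u - v) w = dot u w - dot v w.
Proof. by rewrite dotDl dotNl. Qed.
Lemma dotBr u v w : dot u (v - w) = dot u v - dot u w.
Proof. by rewrite dotDr dotNr. Qed.
Lemma dot_suml (I : Type) (s : seq I) (P : pred I) (F : I -> H) w :
  dot (\sum_(i <- s | P i) F i) w = \sum_(i <- s | P i) dot (F i) w.
Proof. by apply: (big_morph (fun u => dot u w) _ (dot0l w)) => u v; exact: dotDl. Qed.
Lemma dot_sumr (I : Type) (s : seq I) (P : pred I) (F : I -> H) w :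
  dot w (\sum_(i <- s | P i) F i) = \sum_(i <- s | P i) dot w (F i).
Proof. by apply: (big_morph (fun u => dot w u) _ (dot0r w)) => u v; exact: dotDr. Qed.
Lemma redotC u v : re (dot u v) = re (dot v u).
Proof. by rewrite dotC reJ. Qed.
Lemma im_dotuu u : im (dot u u) = 0.
Proof. by have := congr1 (@complex.Im R) (dotC u u); rewrite imJ => h; lra. Qed.
Lemma dotuuE u : dot u u = (re (dot u u))%:C.
Proof. by apply: complex_ext => //=; exact: im_dotuu. Qed.
Lemma dot_ext u v : (forall w, dot u w = dot v w) -> u = v.
Proof.
by move=> h; apply/subr0_eq/dot_eq0; rewrite dotBl h subrr.
Qed.

Lemma nrm_ge0 u : 0 <= nrm u. Proof. exact: sqrtr_ge0. Qed.
Lemma nrm2 u : nrm u ^+ 2 = re (dot u u).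
Proof. by rewrite sqr_sqrtr // dot_ge0. Qed.
Lemma nrm_eq0 u : nrm u = 0 -> u = 0.
Proof. by move=> h; apply: dot_eq0; rewrite -nrm2 h expr0n. Qed.
Lemma nrm0 : nrm 0 = 0. Proof. by rewrite /nrm dot0l sqrtr0. Qed.
Lemma nrmZ a u : nrm (a *: u) = normc a * nrm u.
Proof.
apply/eqP; rewrite -(@eqrXn2 _ 2) ?mulr_ge0 ?nrm_ge0 ?normc_ge0 // exprMn !nrm2.
by rewrite dotZl dotZr mulrA mul_conj reZ.
Qed.
Lemma nrmN u : nrm (- u) = nrm u.
Proof. by rewrite /nrm dotNl dotNr opprK. Qed.
Lemma nrmC u v : nrm (u - v) = nrm (v - u).
Proof. by rewrite -nrmN opprB. Qed.

Lemma cauchy_schwarz u v : normc (dot u v) <= nrm u * nrm v.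
Proof.
rewrite -(@ler_pXn2r _ 2) ?nnegrE ?mulr_ge0 ?nrm_ge0 ?normc_ge0 //.
rewrite exprMn !nrm2 dotC normc_conj; apply: discriminant_le => [|c]; first exact: dot_ge0.
suff <- : re (dot (u + c *: v) (u + c *: v)) =
    re (dot u u) + 2 * re (c * dot v u) + normc c ^+ 2 * re (dot v v).
  exact: dot_ge0.
rewrite -[normc c ^+ 2 * _]reZ -mul_conj dotDl !dotDr !dotZl !dotZr mulrA !reD (dotC v u).
rewrite -[X in _ + X + _]reJ rmorphM /= !conjCK; lra.
Qed.
Lemma cauchy_schwarz_re u v : re (dot u v) <= nrm u * nrm v.
Proof. exact: le_trans (re_le_normc _) (cauchy_schwarz u v). Qed.
Lemma abs_re_dot_small u v (d k : R) : 0 < d -> 0 < k ->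
  nrm u <= d / (k * (nrm v + 1)) -> `|re (dot u v)| <= d / k.
Proof.
move=> d0 k0 h; have n0 : 0 < nrm v + 1 by rewrite ltr_wpDl ?nrm_ge0.
apply: (le_trans (abs_re_le_normc _)); apply: (le_trans (cauchy_schwarz _ _)).
apply: (@le_trans _ _ (d / (k * (nrm v + 1)) * (nrm v + 1))).
  by apply: ler_pM; rewrite ?nrm_ge0 // lerDl.
by rewrite invfM mulrA -mulrA mulVf ?mulr1 // gt_eqF.
Qed.
Lemma nrmD u v : nrm (u + v) <= nrm u + nrm v.
Proof.
rewrite -(@ler_pXn2r _ 2) ?nnegrE ?addr_ge0 ?nrm_ge0 //.
rewrite sqrrD !nrm2 !(dotDl, dotDr) !reD [re (dot v u)]redotC.
have := cauchy_schwarz_re u v; lra.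
Qed.
Lemma nrm2D u v : nrm (u + v) ^+ 2 = nrm u ^+ 2 + 2 * re (dot u v) + nrm v ^+ 2.
Proof. by rewrite !nrm2 !(dotDl, dotDr) !reD [re (dot v u)]redotC; ring. Qed.
Lemma nrm2B u v : nrm (u - v) ^+ 2 = nrm u ^+ 2 - 2 * re (dot u v) + nrm v ^+ 2.
Proof. by rewrite nrm2D nrmN dotNr reN; ring. Qed.
Lemma nrmB u v : nrm (u - v) <= nrm u + nrm v.
Proof. by rewrite (le_trans (nrmD _ _)) // nrmN. Qed.
Lemma nrm_tri u v w : nrm (u - w) <= nrm (u - v) + nrm (v - w).
Proof. by apply: le_trans (nrmD _ _); rewrite subrKA. Qed.

Definition hcvg (u : nat -> H) l := (fun n => nrm (u n - l)) @ \oo --> (0 : R).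

Lemma hcvg_squeeze (f : nat -> R) (u : nat -> H) l :
  (forall n, nrm (u n - l) <= f n) -> f @ \oo --> (0 : R) -> hcvg u l.
Proof.
move=> h; apply: squeeze_cvgr; last exact: cvg_cst.
by near=> n; rewrite nrm_ge0 h.
Unshelve. all: by end_near.
Qed.

Lemma hcvgP (u : nat -> H) l :
  hcvg u l <-> forall e : R, 0 < e -> exists N, forall n, (N <= n)%N -> nrm (u n - l) <= e.
Proof.
split=> [/cvgrPdist_le h e e0|h].
  have [N _ hN] := h e e0; exists N => n /hN /=.
  by rewrite sub0r normrN ger0_norm // nrm_ge0.
apply/cvgrPdist_le => e e0; have [N hN] := h e e0; exists N => // n /= /hN.
by rewrite sub0r normrN ger0_norm // nrm_ge0.
Qed.

Lemma hcvg_sub (f : nat -> nat) (u : nat -> H) l :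
  (forall n, (n <= f n)%N) -> hcvg u l -> hcvg (fun n => u (f n)) l.
Proof.
move=> hf /hcvgP h; apply/hcvgP => e /h[N hN]; exists N => n hn.
exact/hN/(leq_trans hn).
Qed.

Lemma cauchy_hcvg (u : nat -> H) :
  (forall e : R, 0 < e -> exists N, forall m n, (N <= m)%N -> (N <= n)%N ->
     nrm (u m - u n) <= e) -> exists l, hcvg u l.
Proof.
move=> h; have [e e0|l hl] := @hilbert_complete _ H u.
  have [|N hN] := h (Num.sqrt (e / 2)); first by rewrite sqrtr_gt0; lra.
  exists N => m n hm hn.
  have := hN m n hm hn; rewrite -(@ler_pXn2r _ 2) ?nnegrE ?nrm_ge0 ?sqrtr_ge0 //.
  by rewrite nrm2 sqr_sqrtr => [?|]; lra.
exists l; apply/hcvgP => e e0.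
have [|N hN] := hl (e ^+ 2); first by rewrite exprn_gt0.
exists N => n /hN; rewrite -nrm2 => /ltW.
by rewrite ler_pXn2r ?nnegrE ?nrm_ge0 // ltW.
Qed.

Lemma hcvg_cst l : hcvg (fun=> l) l.
Proof. by rewrite /hcvg subrr nrm0; exact: cvg_cst. Qed.
Lemma hcvgD (u v : nat -> H) l m : hcvg u l -> hcvg v m ->
  hcvg (fun n => u n + v n) (l + m).
Proof.
move=> hu hv; apply: (@hcvg_squeeze (fun n => nrm (u n - l) + nrm (v n - m))).
  by move=> n; rewrite opprD addrACA nrmD.
by rewrite -[0](addr0 (0 : R)); apply: cvgD.
Qed.
Lemma hcvgZ a (u : nat -> H) l : hcvg u l -> hcvg (fun n => a *: u n) (a *: l).
Proof.
move=> hu; apply: (@hcvg_squeeze (fun n => normc a * nrm (u n - l))).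
  by move=> n; rewrite -scalerBr nrmZ.
by rewrite -[0](mulr0 (normc a)); apply: cvgZr.
Qed.
Lemma hcvgN (u : nat -> H) l : hcvg u l -> hcvg (fun n => - u n) (- l).
Proof.
move=> hu; apply: (@hcvg_squeeze (fun n => nrm (u n - l))) => // n.
by rewrite -opprD nrmN.
Qed.
Lemma hcvgB (u v : nat -> H) l m : hcvg u l -> hcvg v m ->
  hcvg (fun n => u n - v n) (l - m).
Proof. by move=> hu hv; apply: hcvgD => //; apply: hcvgN. Qed.
Lemma hcvg_sum (I : Type) (s : seq I) (F : I -> nat -> H) (L : I -> H) :
  (forall i, hcvg (F i) (L i)) ->
  hcvg (fun n => \sum_(i <- s) F i n) (\sum_(i <- s) L i).
Proof.
move=> h; elim: s => [|i s IH].
  rewrite big_nil; under eq_fun do rewrite big_nil; exact: hcvg_cst.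
rewrite big_cons; under eq_fun do rewrite big_cons; exact: hcvgD.
Qed.

Lemma cvgr_dist_squeeze (f x : nat -> R) l :
  (forall n, `|x n - l| <= f n) -> f @ \oo --> (0 : R) -> x @ \oo --> l.
Proof.
move=> h hf; apply/cvgrPdist_le => e e0; move/cvgrPdist_le : hf => /(_ e e0).
apply: filterS => n; rewrite sub0r normrN distrC => hn.
exact: (le_trans (h n) (le_trans (ler_norm _) hn)).
Qed.

Lemma hcvg_dot (u v : nat -> H) l m : hcvg u l -> hcvg v m ->
  (fun n => re (dot (u n) (v n))) @ \oo --> re (dot l m).
Proof.
move=> hu hv.
apply: (@cvgr_dist_squeeze (fun n => nrm (u n - l) * nrm (v n - m) +
          (nrm (u n - l) * nrm m + nrm l * nrm (v n - m)))).
  move=> n; rewrite -reB.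
  have -> : dot (u n) (v n) - dot l m =
      dot (u n - l) (v n - m) + (dot (u n - l) m + dot l (v n - m)).
    by rewrite !(dotBl, dotBr); ring.
  apply: (le_trans (abs_re_le_normc _)); apply: (le_trans (le_normcD _ _)).
  apply: lerD; first exact: cauchy_schwarz.
  by apply: (le_trans (le_normcD _ _)); apply: lerD; exact: cauchy_schwarz.
rewrite -[X in _ --> X](_ : 0 * 0 + (0 * nrm m + nrm l * 0) = 0); last by ring.
apply: cvgD; first exact: cvgM.
by apply: cvgD; [apply: cvgMr_tmp|apply: cvgMl_tmp].
Qed.

Lemma hcvg_nrm2 (u : nat -> H) l : hcvg u l ->
  (fun n => nrm (u n) ^+ 2) @ \oo --> nrm l ^+ 2.
Proof.
move=> hu; rewrite nrm2; under eq_fun do rewrite nrm2; exact: hcvg_dot.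
Qed.

Lemma hcvg_uniq (u : nat -> H) l m : hcvg u l -> hcvg u m -> l = m.
Proof.
move=> hl hm; apply/subr0_eq/nrm_eq0; have := hcvg_nrm2 (hcvgB hl hm).
have -> : (fun n => nrm (u n - u n) ^+ 2) = fun=> 0 :> R.
  by apply/funext => n; rewrite subrr nrm0 expr0n.
move=> /(cvg_unique _ (cvg_cst 0)) h.
by apply/eqP; rewrite -sqrf_eq0 -h.
Qed.

Lemma eq_of_normc_cvg0 (f : nat -> R) (x y : R[i]) :
  (forall n, normc (x - y) <= f n) -> f @ \oo --> (0 : R) -> x = y.
Proof.
move=> h hf; apply: eq_of_normc_small => d d0.
move/cvgrPdist_le : hf => /(_ d d0)[N _ /(_ N)/= hN].
apply: (le_trans (h N)); apply: (le_trans (ler_norm _)).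
by have := hN (leqnn _); rewrite sub0r normrN.
Qed.

Lemma hcvg_nrm_le (u : nat -> H) l c : (forall n, nrm (u n) <= c) -> hcvg u l -> nrm l <= c.
Proof.
move=> h /hcvgP hl; apply/ler_addgt0Pr => e e0; have [N hN] := hl e e0.
rewrite -(subrK (u N) l) (le_trans (nrmD _ _)) // addrC lerD // nrmC; exact: hN.
Qed.
End Hilbert.

(** * Self-adjoint operators and their square roots *)

Section Operators.
Variables (R : realType) (H : hilbert R).
Implicit Types (u v w : H) (T : H -> H).

Definition selfadj T := forall u v, dot (T u) v = dot u (T v).
Definition contraction T := forall u, nrm (T u) <= nrm u.
Definition positive T := forall u, 0 <= re (dot (T u) u).

(** Symmetric maps defined on the whole space are linear, since inner products
    determine vectors. *)
Lemma selfadjD T u v : selfadj T -> T (u + v) = T u + T v.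
Proof. by move=> h; apply: dot_ext => w; rewrite dotDl !h dotDl. Qed.
Lemma selfadjZ T a u : selfadj T -> T (a *: u) = a *: T u.
Proof. by move=> h; apply: dot_ext => w; rewrite dotZl !h dotZl. Qed.
Lemma selfadjN T u : selfadj T -> T (- u) = - T u.
Proof. by move=> h; apply: dot_ext => w; rewrite dotNl !h dotNl. Qed.
Lemma selfadjB T u v : selfadj T -> T (u - v) = T u - T v.
Proof. by move=> h; rewrite selfadjD // selfadjN. Qed.
Lemma selfadj0 T : selfadj T -> T 0 = 0.
Proof. by move=> h; rewrite -(subrr 0) selfadjB // !subrr. Qed.
Lemma selfadj_sum T (I : Type) (s : seq I) (F : I -> H) : selfadj T ->
  T (\sum_(i <- s) F i) = \sum_(i <- s) T (F i).
Proof.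
move=> h; elim: s => [|i s IH]; first by rewrite !big_nil selfadj0.
by rewrite !big_cons selfadjD // IH.
Qed.

Lemma selfadj_iter T n : selfadj T -> selfadj (iter n T).
Proof. by move=> h; elim: n => [//|n IH] u v; rewrite iterS h IH -iterSr. Qed.

Lemma hcvg_op T c (u : nat -> H) l : selfadj T -> (forall v, nrm (T v) <= c * nrm v) ->
  hcvg u l -> hcvg (fun n => T (u n)) (T l).
Proof.
move=> sT bT hu; apply: (@hcvg_squeeze _ _ (fun n => c * nrm (u n - l))).
  by move=> n; rewrite -selfadjB.
by rewrite -[0](mulr0 c); apply: cvgZr.
Qed.

Lemma nondecreasing_cauchy (s : nat -> R) (B : R) :
  (forall n, s n <= s n.+1) -> (forall n, s n <= B) ->
  forall e : R, 0 < e -> exists N, forall m n, (N <= m)%N -> (N <= n)%N -> s m - s n <= e.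
Proof.
move=> h1 hB e e0; have hm : nondecreasing_seq s by apply/nondecreasing_seqP.
have hs : has_sup (range s).
  by split; [exists (s 0%N); exists 0%N|exists B => _ [n _ <-]].
have [_ [N _ <-] hN] := sup_adherent e0 hs.
exists N => m n _ /hm hn.
have : s m <= sup (range s) by apply: ub_le_sup; [exact: hs.2|exists m].
lra.
Qed.

Section SquareRoot.
Variable Q : H -> H.
Hypotheses (saQ : selfadj Q) (cQ : contraction Q).

(** If [Y = (Q + Y ^ 2) / 2] then [1 - Y] is a square root of [1 - Q].  The
    scalar sequence [maj] is the same iteration for [Q = 1]; it dominates the
    operator iteration, increments included, which is what makes the latter
    converge. *)
Fixpoint iterate n u : H :=
  if n is n'.+1 then (2^-1)%:C *: (Q u + iterate n' (iterate n' u)) else 0.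
Fixpoint maj n : R := if n is n'.+1 then 2^-1 * (1 + maj n' ^+ 2) else 0.

Lemma maj_bounds n : 0 <= maj n <= 1.
Proof.
elim: n => [|n /andP[h0 h1]] /=; first by rewrite lexx ler01.
have : maj n ^+ 2 <= 1 by rewrite expr_le1.
by have := sqr_ge0 (maj n) => *; apply/andP; split; lra.
Qed.
Lemma maj_ge0 n : 0 <= maj n. Proof. by have /andP[] := maj_bounds n. Qed.
Lemma maj_incr n : maj n <= maj n.+1.
Proof. by rewrite /=; have := sqr_ge0 (maj n - 1); rewrite sqrrB; lra. Qed.

Lemma nrm_half u : nrm ((2^-1)%:C *: u) = 2^-1 * nrm u.
Proof. by rewrite nrmZ normc_real ger0_norm // invr_ge0. Qed.

Lemma selfadj_iterate n : selfadj (iterate n).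
Proof.
elim: n => [|n IH] u v /=; first by rewrite dot0l dot0r.
by rewrite dotZl dotZr !dotDl !dotDr saQ !IH conj_real.
Qed.

Lemma nrm_iterate n u : nrm (iterate n u) <= maj n * nrm u.
Proof.
elim: n u => [|n IH] u /=; first by rewrite nrm0 mul0r.
rewrite nrm_half -mulrA ler_pM2l ?invr_gt0 // mulrDl mul1r.
apply: (le_trans (nrmD _ _)); apply: lerD; first exact: cQ.
by rewrite expr2 -mulrA (le_trans (IH _)) // ler_wpM2l ?maj_ge0.
Qed.

Lemma nrm_iterate_incr n u :
  nrm (iterate n.+1 u - iterate n u) <= (maj n.+1 - maj n) * nrm u.
Proof.
elim: n u => [|n IH] u.
  have := nrm_iterate 1 u; by rewrite /= !subr0.
rewrite [iterate n.+2]/= -/(iterate n.+1) [X in _ - X]/= -scalerBr nrm_half.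
rewrite (_ : _ - _ = iterate n.+1 (iterate n.+1 u - iterate n u) +
                    (iterate n.+1 (iterate n u) - iterate n (iterate n u))); last first.
  rewrite (selfadjB _ _ (selfadj_iterate _)) subrKA.
  by rewrite opprD addrACA subrr add0r.
have e : maj n.+2 - maj n.+1 = 2^-1 * (maj n.+1 * (maj n.+1 - maj n) + (maj n.+1 - maj n) * maj n).
  rewrite [maj n.+2]/= -/(maj n.+1) [X in _ - X]/= ; ring.
rewrite {}e -mulrA ler_pM2l ?invr_gt0 // mulrDl.
apply: (le_trans (nrmD _ _)); apply: lerD.
  apply: (le_trans (nrm_iterate _ _)); rewrite -mulrA ler_wpM2l ?maj_ge0 //.
apply: (le_trans (IH _)); rewrite -mulrA ler_wpM2l ?nrm_iterate //.
by rewrite subr_ge0 maj_incr.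
Qed.

Lemma nrm_iterateB n k u :
  nrm (iterate (n + k) u - iterate n u) <= (maj (n + k) - maj n) * nrm u.
Proof.
elim: k => [|k IH]; first by rewrite addn0 !subrr nrm0 mul0r.
apply: (le_trans (nrm_tri _ (iterate (n + k) u) _)).
rewrite addnS -(subrKA (maj (n + k)) (maj _.+1)) mulrDl; apply: lerD => //.
exact: nrm_iterate_incr.
Qed.

Lemma iterate_cauchy u : exists l, hcvg (fun n => iterate n u) l.
Proof.
apply: cauchy_hcvg => e e0.
have e1 : 0 < e / (nrm u + 1) by rewrite divr_gt0 // ltr_wpDl ?nrm_ge0.
have [|N hN] := nondecreasing_cauchy maj_incr (B := 1) _ e1.
  by move=> n; have /andP[] := maj_bounds n.
exists N => m n; wlog mn : m n / (n <= m)%N.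
  move=> h hm hn; have [|/ltnW] := leqP n m; first by move=> /h; apply.
  by rewrite nrmC => /h; apply.
move=> hm hn; rewrite -(subnKC mn); apply: (le_trans (nrm_iterateB _ _ _)).
rewrite subnKC //; apply: (@le_trans _ _ (e / (nrm u + 1) * nrm u)).
  by rewrite ler_wpM2r ?nrm_ge0 // hN.
rewrite mulrAC -mulrA ler_piMr ?(ltW e0) // ler_pdivrMr ?ltr_wpDl ?nrm_ge0 //.
by rewrite mul1r lerDl.
Qed.

Definition iterate_lim u := projT1 (cid (iterate_cauchy u)).
Lemma iterate_limP u : hcvg (fun n => iterate n u) (iterate_lim u).
Proof. exact: projT2 (cid (iterate_cauchy u)). Qed.

Lemma selfadj_iterate_lim : selfadj iterate_lim.
Proof.
move=> u v; apply: re_mul_ext => c.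
have := hcvg_dot (hcvgZ c (iterate_limP u)) (hcvg_cst v).
have := hcvg_dot (hcvg_cst (c *: u)) (iterate_limP v).
have -> : (fun n => re (dot (c *: u) (iterate n v))) =
          (fun n => re (dot (c *: iterate n u) v)).
  by apply/funext => n; rewrite !dotZl selfadj_iterate.
move=> h1 /(cvg_unique _ h1); rewrite !dotZl => -> //.
Qed.

Lemma nrm_iterate_le n u : nrm (iterate n u) <= nrm u.
Proof.
apply: (le_trans (nrm_iterate _ _)); rewrite ler_piMl ?nrm_ge0 //.
by have /andP[] := maj_bounds n.
Qed.

Lemma contraction_iterate_lim : contraction iterate_lim.
Proof. by move=> u; apply: (hcvg_nrm_le _ (iterate_limP u)) => n; exact: nrm_iterate_le. Qed.

Lemma iterate_lim_fix u :
  iterate_lim u = (2^-1)%:C *: (Q u + iterate_lim (iterate_lim u)).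
Proof.
have h1 := hcvg_sub leqnSn (iterate_limP u).
apply: (hcvg_uniq h1); rewrite /=; apply/hcvgZ/hcvgD; first exact: hcvg_cst.
apply: (@hcvg_squeeze _ _ (fun n => nrm (iterate n u - iterate_lim u) +
   nrm (iterate n (iterate_lim u) - iterate_lim (iterate_lim u)))).
  move=> n; apply: (le_trans (nrm_tri _ (iterate n (iterate_lim u)) _)).
  by rewrite lerD2r -(selfadjB _ _ (selfadj_iterate _)) nrm_iterate_le.
by rewrite -[0](addr0 (0 : R)); apply: cvgD; exact: iterate_limP.
Qed.

End SquareRoot.

Lemma nrm2_le_form T u : selfadj T -> positive T ->
  (forall v, re (dot (T v) v) <= nrm v ^+ 2) -> nrm (T u) ^+ 2 <= re (dot (T u) u).
Proof.
move=> saT pT bT; have := pT (u - T u); have := bT (T u).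
rewrite selfadjB // !(dotBl, dotBr) !reB [dot (T (T u)) u]saT -!nrm2; lra.
Qed.

(** The root is [1 - Y], where [Y] is the limit of the iteration for [1 - T].
    Whatever commutes with [T] commutes with every iterate, and boundedness
    carries this to the limit. *)
Lemma operator_sqrt T : selfadj T -> positive T ->
  (forall u, re (dot (T u) u) <= nrm u ^+ 2) ->
  exists S, [/\ selfadj S, positive S, forall u, S (S u) = T u, contraction S &
    forall E c, selfadj E -> (forall u, nrm (E u) <= c * nrm u) ->
      (forall u, E (T u) = T (E u)) -> forall u, E (S u) = S (E u)].
Proof.
move=> saT pT bT; pose Q u := u - T u.
have saQ : selfadj Q by move=> u v; rewrite dotBl dotBr saT.
have cQ : contraction Q.
  move=> u; rewrite -(@ler_pXn2r _ 2) ?nnegrE ?nrm_ge0 //.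
  apply: (@le_trans _ _ (re (dot (Q u) u))); last first.
    by rewrite dotBl reB -nrm2 gerBl pT.
  apply: nrm2_le_form => // v; first by rewrite dotBl reB -nrm2 subr_ge0.
  by rewrite dotBl reB -nrm2 gerBl pT.
pose Y := iterate_lim saQ cQ.
have saY : selfadj Y := selfadj_iterate_lim saQ cQ.
have cY : contraction Y := contraction_iterate_lim saQ cQ.
pose S u := u - Y u.
have saS : selfadj S by move=> u v; rewrite dotBl dotBr saY.
have SS u : S (S u) = T u.
  have hY : Y u + Y u = u - T u + Y (Y u).
    have e := iterate_lim_fix saQ cQ u; rewrite -/Y in e.
    have h2 : 2^-1 + 2^-1 = 1 :> R by lra.
    rewrite -[RHS](scale1r (Q u + Y (Y u))) -(rmorph1 (real_complex R)) -h2 rmorphD.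
    by rewrite scalerDl -e.
  rewrite /S selfadjB // opprB addrA addrAC -[u - Y u - Y u]addrA -opprD hY.
  by rewrite opprD opprB addrA subrK addrC subrK.
exists S; split => //.
- move=> u; rewrite dotBl reB -nrm2 subr_ge0 (le_trans (cauchy_schwarz_re _ _)) //.
  by rewrite expr2 ler_wpM2r ?nrm_ge0.
- move=> u; rewrite -(@ler_pXn2r _ 2) ?nnegrE ?nrm_ge0 //.
  by rewrite nrm2 -saS SS.
move=> E c saE bE ET u; rewrite /S selfadjB //; congr (_ - _).
have EY n v : E (iterate Q n v) = iterate Q n (E v).
  elim: n v => [|n IH] v /=; first exact: selfadj0.
  by rewrite selfadjZ // selfadjD // !IH selfadjB // ET.
apply: (hcvg_uniq (hcvg_op saE bE (iterate_limP saQ cQ u))).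
have := iterate_limP saQ cQ (E u).
by under eq_fun do rewrite -EY.
Qed.

End Operators.

(** * Quadratic forms of kernels *)

Section Forms.
Variables (R : realType) (J : Type).
Implicit Types (K L : ckernel R J) (s t : seq (R[i] * J)) (c : R[i]).

(** A finite sequence of weighted points stands for a finitely supported
    function; concatenation is addition.  Points may be repeated, so no
    normal form is needed. *)
Definition form K s t : R[i] :=
  \sum_(p <- s) \sum_(r <- t) p.1 * r.1^* * K p.2 r.2.
Definition qf K s : R := re (form K s s).
Definition scl c s : seq (R[i] * J) := [seq (c * p.1, p.2) | p <- s].
Definition sub_seq s t := s ++ scl (-1) t.

Lemma form_catl K s1 s2 t : form K (s1 ++ s2) t = form K s1 t + form K s2 t.
Proof. by rewrite /form big_cat. Qed.
Lemma form_catr K s t1 t2 : form K s (t1 ++ t2) = form K s t1 + form K s t2.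
Proof. by rewrite /form -big_split; apply: eq_bigr => p _; rewrite big_cat. Qed.
Lemma form_scll K c s t : form K (scl c s) t = c * form K s t.
Proof.
rewrite /form /scl big_map mulr_sumr; apply: eq_bigr => p _ /=.
by rewrite mulr_sumr; apply: eq_bigr => r _; rewrite !mulrA.
Qed.
Lemma form_sclr K c s t : form K s (scl c t) = c^* * form K s t.
Proof.
rewrite /form /scl mulr_sumr; apply: eq_bigr => p _ /=.
by rewrite big_map mulr_sumr; apply: eq_bigr => r _ /=; rewrite rmorphM; ring.
Qed.

Lemma form_kernelD K L s t :
  form (fun x y => K x y + L x y) s t = form K s t + form L s t.
Proof.
rewrite /form -big_split; apply: eq_bigr => p _; rewrite -big_split.
by apply: eq_bigr => r _; rewrite mulrDr.
Qed.
Lemma form_kernelZ c K s t : form (fun x y => c * K x y) s t = c * form K s t.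
Proof.
rewrite /form mulr_sumr; apply: eq_bigr => p _; rewrite mulr_sumr.
by apply: eq_bigr => r _; ring.
Qed.
Lemma form_kernelB K L s t :
  form (fun x y => K x y - L x y) s t = form K s t - form L s t.
Proof.
rewrite -[- form L s t]mulN1r -form_kernelZ -form_kernelD.
by congr form; apply/funext => x; apply/funext => y; rewrite mulN1r.
Qed.
Lemma qf_kernelD K L s : qf (fun x y => K x y + L x y) s = qf K s + qf L s.
Proof. by rewrite /qf form_kernelD reD. Qed.
Lemma qf_kernelB K L s : qf (fun x y => K x y - L x y) s = qf K s - qf L s.
Proof. by rewrite /qf form_kernelB reB. Qed.
Lemma qf_kscale a K s : qf (kscale a K) s = a * qf K s.
Proof. by rewrite /qf form_kernelZ reZ. Qed.

Lemma form_pt K c d x y : form K [:: (c, x)] [:: (d, y)] = c * d^* * K x y.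
Proof. by rewrite /form !big_seq1. Qed.

Lemma posdefP K : posdef K <-> forall s, 0 <= form K s s.
Proof.
split=> [h s|h n x l _].
  case: s => [|p0 s0]; first by rewrite /form big_nil.
  set s := p0 :: s0.
  have := h (size s) (fun i => (nth p0 s i).2) (fun i => (nth p0 s i).1) isT.
  rewrite /form (big_nth p0) big_mkord /=; congr (_ <= _); apply: eq_bigr => i _.
  by rewrite (big_nth p0) big_mkord.
have := h [seq (l j, x j) | j <- enum 'I_n].
rewrite /form big_map big_enum /=; congr (_ <= _); apply: eq_bigr => i _.
by rewrite big_map big_enum.
Qed.

Lemma posdef_qf_ge0 K s : posdef K -> 0 <= qf K s.
Proof. by move=> /posdefP/(_ s); rewrite ge0_complexE => /andP[]. Qed.
Lemma posdef_im0 K s : posdef K -> im (form K s s) = 0.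
Proof. by move=> /posdefP/(_ s); rewrite ge0_complexE => /andP[/eqP]. Qed.
Lemma posdef_qfE K s : posdef K -> form K s s = (qf K s)%:C.
Proof. by move=> hK; apply: complex_ext => //=; exact: posdef_im0. Qed.

(** Positivity on two points makes the kernel hermitian: the imaginary parts
    for the weights [(1, 1)] and [(1, i)] vanish. *)
Lemma posdef_conj K x y : posdef K -> K y x = (K x y)^*.
Proof.
move=> hK; have h c d := posdef_im0 [:: (c, x); (d, y)] hK.
have {}h c d : im (c * c^* * K x x + d * d^* * K y y + (c * d^* * K x y + d * c^* * K y x)) = 0.
  rewrite -(h c d) /form !big_cons !big_nil /= !addr0; congr im; ring.
have hx := h 1 0; have hy := h 0 1; have h1 := h 1 1; have h2 := h 1 'i%C.
apply: complex_ext; rewrite ?reJ ?imJ;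
  move: hx hy h1 h2; rewrite !(imD, imM, reM, imJ, reJ, reD) /=; lra.
Qed.

Lemma form_conj K s t : posdef K -> form K t s = (form K s t)^*.
Proof.
move=> hK; rewrite /form rmorph_sum exchange_big; apply: eq_bigr => p _.
rewrite rmorph_sum; apply: eq_bigr => r _.
by rewrite /= !rmorphM /= conjCK -(posdef_conj _ _ hK); ring.
Qed.

Lemma qf_cat K s t : posdef K ->
  qf K (s ++ t) = qf K s + 2 * re (form K s t) + qf K t.
Proof.
move=> hK; rewrite /qf form_catl !form_catr !reD (form_conj t s hK) reJ.
by rewrite -[re (form K t s)]reJ -(form_conj _ _ hK); lra.
Qed.
Lemma qf_scl K c s : qf K (scl c s) = normc c ^+ 2 * qf K s.
Proof. by rewrite /qf form_scll form_sclr mulrA mul_conj reZ. Qed.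
Lemma qf_sub K s t : posdef K ->
  qf K (sub_seq s t) = qf K s - 2 * re (form K s t) + qf K t.
Proof.
move=> hK; rewrite qf_cat // qf_scl form_sclr normcN normc1 expr1n mul1r.
by rewrite rmorphN rmorph1 mulN1r reN; lra.
Qed.

Lemma form_cauchy_schwarz K s t : posdef K ->
  normc (form K s t) ^+ 2 <= qf K s * qf K t.
Proof.
move=> hK; rewrite (form_conj _ _ hK) normc_conj; apply: discriminant_le => [|c].
  exact: posdef_qf_ge0.
have := posdef_qf_ge0 (s ++ scl c t) hK.
rewrite qf_cat // qf_scl form_sclr -[re (c^* * _)]reJ rmorphM /= conjCK.
by rewrite -(form_conj _ _ hK).
Qed.

Lemma kle_qf K L s : kle K L -> qf K s <= qf L s.
Proof. by move=> /(posdef_qf_ge0 s); rewrite qf_kernelB subr_ge0. Qed.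

Lemma qf_kle K L : posdef K -> posdef L -> (forall s, qf K s <= qf L s) -> kle K L.
Proof.
move=> hK hL h; apply/posdefP => s; rewrite form_kernelB !posdef_qfE // -rmorphB /=.
by rewrite ler0c subr_ge0.
Qed.

Lemma kle_anti K L : kle K L -> kle L K -> K = L.
Proof.
move=> h1 h2; apply/funext => x; apply/funext => y; apply/esym/subr0_eq.
have := form_cauchy_schwarz [:: (1, x)] [:: (1, y)] h1.
have -> : qf (fun x y => L x y - K x y) [:: (1, x)] = 0.
  apply/le_anti; rewrite (posdef_qf_ge0 _ h1) andbT qf_kernelB subr_le0; exact: kle_qf.
rewrite mul0r form_pt mul1r rmorph1 mul1r => h.
by apply/eqP; rewrite -normc_eq0 -sqrf_eq0; apply/eqP/le_anti; rewrite h sqr_ge0.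
Qed.

Lemma posdefD K L : posdef K -> posdef L -> posdef (fun x y => K x y + L x y).
Proof.
move=> /posdefP h1 /posdefP h2; apply/posdefP => s.
by rewrite form_kernelD addr_ge0.
Qed.
Lemma posdef_kscale a K : 0 <= a -> posdef K -> posdef (kscale a K).
Proof.
move=> a0 /posdefP h; apply/posdefP => s.
by rewrite form_kernelZ mulr_ge0 // ler0c.
Qed.

Section Combinations.
Variables (H : hilbert R) (e f : J -> H).

Definition comb (e : J -> H) s : H := \sum_(p <- s) p.1 *: e p.2.
Lemma comb_cat s t : comb e (s ++ t) = comb e s + comb e t.
Proof. by rewrite /comb big_cat. Qed.
Lemma comb_scl c s : comb e (scl c s) = c *: comb e s.
Proof.
rewrite /comb big_map scaler_sumr; apply: eq_bigr => p _; by rewrite scalerA.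
Qed.
Lemma comb_sub s t : comb e (sub_seq s t) = comb e s - comb e t.
Proof. by rewrite comb_cat comb_scl scaleN1r. Qed.
Lemma comb_pt c x : comb e [:: (c, x)] = c *: e x.
Proof. by rewrite /comb big_seq1. Qed.
Lemma dot_comb s t :
  dot (comb e s) (comb f t) = form (fun x y => dot (e x) (f y)) s t.
Proof.
rewrite /comb /form dot_suml; apply: eq_bigr => p _; rewrite dot_sumr.
by apply: eq_bigr => r _; rewrite dotZl dotZr mulrA.
Qed.
End Combinations.

Lemma posdef_gram (H : hilbert R) (e : J -> H) : posdef (fun x y => dot (e x) (e y)).
Proof.
by apply/posdefP => s; rewrite -dot_comb dotuuE ler0c dot_ge0.
Qed.
Lemma qf_gram (H : hilbert R) (e : J -> H) s :
  qf (fun x y => dot (e x) (e y)) s = nrm (comb e s) ^+ 2.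
Proof. by rewrite /qf -dot_comb nrm2. Qed.

End Forms.

(** * The regular part of a quadratic form *)

Section PolarDecomposition.
Variables (R : realType) (H : hilbert R) (J : Type).
Variables (e : J -> H) (q : ckernel R J).
Hypothesis pq : posdef q.
Implicit Types (s t : seq (R[i] * J)) (g u v : H).

Let w := comb e.
Let G : ckernel R J := fun x y => q x y + dot (e x) (e y).
Let pG : posdef G. Proof. exact: posdefD pq (posdef_gram e). Qed.

Let qfG s : qf G s = qf q s + nrm (w s) ^+ 2.
Proof. by rewrite qf_kernelD qf_gram. Qed.
Let ng s : R := Num.sqrt (qf G s).
Let ng_ge0 s : 0 <= ng s. Proof. exact: sqrtr_ge0. Qed.
Let ng2 s : ng s ^+ 2 = qf G s.
Proof. by rewrite sqr_sqrtr // posdef_qf_ge0. Qed.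
Let nrm_le_ng s : nrm (w s) <= ng s.
Proof.
rewrite -(@ler_pXn2r _ 2) ?nnegrE ?nrm_ge0 // ng2 qfG lerDr.
exact: posdef_qf_ge0.
Qed.
Let form_le_ng s t : normc (form G s t) <= ng s * ng t.
Proof.
rewrite -(@ler_pXn2r _ 2) ?nnegrE ?mulr_ge0 ?normc_ge0 // exprMn !ng2.
exact: form_cauchy_schwarz.
Qed.

(** Almost maximizing [2 Re <w s, g> - G s] represents the functional
    [t |-> <w t, g>] by an element [s], up to a small error. *)
Lemma approx_riesz g (d : R) : 0 < d ->
  exists s, forall t, normc (form G t s - dot (w t) g) <= d * ng t.
Proof.
move=> d0; pose F s : R := 2 * re (dot (w s) g) - qf G s.
have hF s : F s <= nrm g ^+ 2.
  rewrite /F; have := cauchy_schwarz_re (w s) g; have := nrm_le_ng s.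
  rewrite -ng2; have := nrm_ge0 g; have := nrm_ge0 (w s).
  have := sqr_ge0 (nrm (w s) - nrm g); rewrite sqrrB => h1 h2 h3 h4 h5.
  have : nrm (w s) ^+ 2 <= ng s ^+ 2 by rewrite ler_pXn2r ?nnegrE.
  lra.
have hs : has_sup (range F).
  by split; [exists (F [::]), [::]|exists (nrm g ^+ 2) => _ [s _ <-]].
have d2 : 0 < d ^+ 2 by rewrite exprn_gt0.
have [_ [s _ <-] hsup] := sup_adherent d2 hs.
exists s => t; rewrite -(@ler_pXn2r _ 2) ?nnegrE ?mulr_ge0 ?normc_ge0 ?(ltW d0) //.
rewrite exprMn ng2.
have -> : form G t s - dot (w t) g = (form G s t - dot g (w t))^*.
  by rewrite rmorphB /= -(form_conj _ _ pG) -dotC.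
rewrite normc_conj; apply: discriminant_le => [|c]; first exact: posdef_qf_ge0.
have : F (s ++ scl c^* t) <= sup (range F).
  by apply: ub_le_sup; [exact: hs.2|exists (s ++ scl c^* t)].
rewrite /F /w qf_cat // qf_scl normc_conj form_sclr conjCK comb_cat comb_scl dotDl dotZl.
rewrite reD -[re (c^* * _)]reJ rmorphM /= conjCK -dotC mulrBr reB.
move: hsup; rewrite /F /w; lra.
Qed.

Let eps n : R := n.+1%:R^-1.
Let eps_gt0 n : 0 < eps n. Proof. by rewrite invr_gt0. Qed.
Let eps_le1 n : eps n <= 1. Proof. by rewrite invf_le1 // ler1n. Qed.
Let eps_cvg : eps @ \oo --> (0 : R). Proof. exact: cvg_harmonic. Qed.

Let sg g n := projT1 (cid (approx_riesz g (eps_gt0 n))).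
Let sgP g n t : normc (form G t (sg g n) - dot (w t) g) <= eps n * ng t.
Proof. exact: (projT2 (cid (approx_riesz g (eps_gt0 n)))). Qed.

Let ng_sg g n : ng (sg g n) <= nrm g + 1.
Proof.
have h : ng (sg g n) ^+ 2 <= (nrm g + 1) * ng (sg g n).
  rewrite ng2 /qf -(subrK (dot (w (sg g n)) g) (form G _ _)) reD mulrDl addrC mul1r.
  apply: lerD.
    apply: (le_trans (cauchy_schwarz_re _ _)); rewrite mulrC.
    by rewrite ler_wpM2l ?nrm_ge0.
  apply: (le_trans (re_le_normc _)); apply: (le_trans (sgP _ _ _)).
  by rewrite ler_piMl.
have [h0|h0] := leP (ng (sg g n)) 0; first by rewrite (le_trans h0) // addr_ge0 ?nrm_ge0.
by rewrite -(ler_pM2r h0) -expr2.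
Qed.

Let sg_cauchy g m n : nrm (w (sg g m) - w (sg g n)) <= eps m + eps n.
Proof.
rewrite /w -comb_sub -/w; set t := sub_seq _ _; apply: (le_trans (nrm_le_ng _)).
have h : ng t ^+ 2 <= (eps m + eps n) * ng t.
  rewrite ng2 /qf {2}/t form_catr form_sclr rmorphN rmorph1 mulN1r.
  rewrite -(subrKA (dot (w t) g)) reD mulrDl.
  apply: lerD; apply: (le_trans (re_le_normc _)); first exact: sgP.
  by rewrite -normcN opprB; exact: sgP.
have [h0|h0] := leP (ng t) 0; first by rewrite (le_trans h0) // addr_ge0 // ltW.
by rewrite -(ler_pM2r h0) -expr2.
Qed.

Let resolvent_ex g : exists l, hcvg (fun n => w (sg g n)) l.
Proof.
apply: cauchy_hcvg => d d0.
have /cvgrPdist_le/(_ (d / 2)) := eps_cvg.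
case=> [|N _ hN]; first by rewrite divr_gt0.
exists N => m n /hN hm /hN hn; apply: (le_trans (sg_cauchy _ _ _)).
move: hm hn; rewrite /= !sub0r !normrN !ger0_norm ?(ltW (eps_gt0 _)) //; lra.
Qed.

(** If [q] is the form [<T v, v>] of a positive self-adjoint operator [T] on
    [H], pulled back along [e], this is the resolvent [(1 + T) ^ -1]; in
    general, it is [i i'] for the map [i] into [H] from the completion of the
    combinations under [G] and its adjoint [i']. *)
Let Rop g := projT1 (cid (resolvent_ex g)).
Let RopP g : hcvg (fun n => w (sg g n)) (Rop g).
Proof. exact: (projT2 (cid (resolvent_ex g))). Qed.

Let form_sg g' g n :
  normc (form G (sg g' n) (sg g n) - dot (w (sg g' n)) g) <= eps n * (nrm g' + 1).
Proof.
by apply: (le_trans (sgP _ _ _)); rewrite ler_wpM2l ?ng_sg ?ltW.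
Qed.

Let selfadj_R : selfadj Rop.
Proof.
move=> g' g.
apply: (@eq_of_normc_cvg0 _ (fun n => nrm (w (sg g' n) - Rop g') * nrm g +
  (eps n * (nrm g' + 1) + (eps n * (nrm g + 1) + nrm g' * nrm (w (sg g n) - Rop g))))).
  move=> n; set d := form G (sg g' n) (sg g n).
  have -> : dot (Rop g') g - dot g' (Rop g) =
     - dot (w (sg g' n) - Rop g') g + (- (d - dot (w (sg g' n)) g) +
     ((form G (sg g n) (sg g' n) - dot (w (sg g n)) g')^* + dot g' (w (sg g n) - Rop g))).
    rewrite rmorphB /= -(form_conj _ _ pG) -dotC -/d dotBl dotBr; ring.
  apply: (le_trans (le_normcD _ _)); apply: lerD.
    by rewrite normcN cauchy_schwarz.
  apply: (le_trans (le_normcD _ _)); apply: lerD; first by rewrite normcN form_sg.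
  apply: (le_trans (le_normcD _ _)); apply: lerD; first by rewrite normc_conj form_sg.
  exact: cauchy_schwarz.
rewrite -[X in _ --> X](_ : 0 * nrm g + (0 * (nrm g' + 1) + (0 * (nrm g + 1) + nrm g' * 0)) = 0);
  last by ring.
apply: cvgD; first by apply: cvgMr_tmp; exact: RopP.
apply: cvgD; first exact: cvgMr_tmp.
apply: cvgD; first exact: cvgMr_tmp.
by apply: cvgMl_tmp; exact: RopP.
Qed.

Let qf_sg g : (fun n => qf G (sg g n)) @ \oo --> re (dot (Rop g) g).
Proof.
have h := hcvg_dot (RopP g) (hcvg_cst g).
rewrite -[X in _ --> X]addr0 (_ : (fun n => _) = fun n => re (dot (w (sg g n)) g) +
   re (form G (sg g n) (sg g n) - dot (w (sg g n)) g)); last first.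
  by apply/funext => n; rewrite -reD addrC subrK.
apply: cvgD => //; apply: (@cvgr_dist_squeeze _ (fun n => eps n * (nrm g + 1))).
  by move=> n; rewrite subr0 (le_trans (abs_re_le_normc _)) // form_sg.
by rewrite -[0](mul0r (nrm g + 1)); apply: cvgMr_tmp.
Qed.

Let nrm2_R g : nrm (Rop g) ^+ 2 <= re (dot (Rop g) g).
Proof.
apply: (ler_cvg_to (hcvg_nrm2 (RopP g)) (@qf_sg g)).
by apply: nearW => n; rewrite -ng2 ler_pXn2r ?nnegrE ?nrm_ge0.
Qed.

Let form_bound g s : re (dot (w s) g) ^+ 2 <= qf G s * re (dot (Rop g) g).
Proof.
have h : (fun n => qf G s * (qf G (sg g n) + eps n * (2 * (nrm g + 1) + 1))) @ \oo -->
    qf G s * (re (dot (Rop g) g) + 0 * (2 * (nrm g + 1) + 1)).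
  by apply: cvgMl_tmp; apply: cvgD; [exact: qf_sg|apply: cvgMr_tmp].
rewrite mul0r addr0 in h; apply: (ler_cvg_to (cvg_cst _) h); apply: nearW => n.
rewrite -[_ ^+ 2]real_normK ?num_real //.
have h1 : `|re (dot (w s) g)| <= ng s * (ng (sg g n) + eps n).
  apply: (le_trans (abs_re_le_normc _)).
  rewrite -(subrK (form G s (sg g n)) (dot _ _)) mulrDr addrC.
  apply: (le_trans (le_normcD _ _)); apply: lerD => //.
  by rewrite -normcN opprB mulrC.
have h2 : `|re (dot (w s) g)| ^+ 2 <= (ng s * (ng (sg g n) + eps n)) ^+ 2.
  by rewrite ler_pXn2r ?nnegrE // mulr_ge0 // addr_ge0 // ltW.
apply: (le_trans h2); rewrite exprMn ng2 ler_wpM2l ?posdef_qf_ge0 //.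
rewrite sqrrD ng2 -addrA lerD2l.
have h3 := ng_sg g n; have h4 := eps_gt0 n; have h5 := eps_le1 n.
have -> : ng (sg g n) * eps n *+ 2 + eps n ^+ 2 = eps n * (2 * ng (sg g n) + eps n).
  by ring.
by rewrite ler_wpM2l ?(ltW h4) //; lra.
Qed.

Let pos_R : positive Rop.
Proof. by move=> g; apply: le_trans (nrm2_R g); rewrite sqr_ge0. Qed.
Let R_le g : re (dot (Rop g) g) <= nrm g ^+ 2.
Proof.
have h := nrm2_R g; have h1 := cauchy_schwarz_re (Rop g) g.
have h2 := sqr_ge0 (nrm (Rop g) - nrm g); rewrite sqrrB in h2; lra.
Qed.

Let A u := u - Rop u.
Let selfadj_A : selfadj A.
Proof. by move=> u v; rewrite dotBl dotBr selfadj_R. Qed.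
Let pos_A : positive A.
Proof. by move=> u; rewrite dotBl reB -nrm2 subr_ge0. Qed.
Let A_le u : re (dot (A u) u) <= nrm u ^+ 2.
Proof. by rewrite dotBl reB -nrm2 gerBl. Qed.
Let AR u : A (Rop u) = Rop (A u).
Proof. by rewrite /A selfadjB. Qed.

Let rA u := Rop (A u).
Let selfadj_rA : selfadj rA.
Proof. by move=> u v; rewrite /rA selfadj_R selfadj_A AR. Qed.
Let rA_form u : re (dot (rA u) u) = re (dot (Rop u) u) - nrm (Rop u) ^+ 2.
Proof. by rewrite /rA -AR dotBl reB [dot (Rop (Rop u)) u]selfadj_R nrm2. Qed.
Let pos_rA : positive rA.
Proof. by move=> u; rewrite rA_form subr_ge0. Qed.
Let rA_le u : re (dot (rA u) u) <= nrm u ^+ 2.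
Proof. by rewrite rA_form (le_trans _ (R_le u)) // gerBl sqr_ge0. Qed.

Let rootA := cid (operator_sqrt selfadj_A pos_A A_le).
Let B := projT1 rootA.
Let selfadj_B : selfadj B. Proof. by have [] := projT2 rootA. Qed.
Let BB u : B (B u) = A u. Proof. by have [] := projT2 rootA. Qed.
Let contraction_B : contraction B. Proof. by have [] := projT2 rootA. Qed.

(** In terms of [Rop = (1 + T) ^ -1], this is [T ^ (1/2) (1 + T) ^ -1]. *)
Let rootRA := cid (operator_sqrt selfadj_rA pos_rA rA_le).
Let D := projT1 rootRA.
Let selfadj_D : selfadj D. Proof. by have [] := projT2 rootRA. Qed.
Let pos_D : positive D. Proof. by have [] := projT2 rootRA. Qed.
Let DD u : D (D u) = rA u. Proof. by have [] := projT2 rootRA. Qed.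
Let contraction_D : contraction D. Proof. by have [] := projT2 rootRA. Qed.
Let nrm2_D u : nrm (D u) ^+ 2 = re (dot (rA u) u).
Proof. by rewrite nrm2 -selfadj_D DD. Qed.

Let DA u : D (A u) = A (D u).
Proof.
have [_ _ _ _ h] := projT2 rootRA.
symmetry; apply: (h A 1) => // [v|v]; last by rewrite /rA AR.
rewrite mul1r -BB; exact: le_trans (contraction_B _) (contraction_B _).
Qed.
Let DB u : D (B u) = B (D u).
Proof.
have [_ _ _ _ h] := projT2 rootA.
by apply: (h D 1) => // v; rewrite mul1r; exact: contraction_D.
Qed.

Let iterA n u : iter n A u = iter n B (iter n B u).
Proof.
elim: n u => [//|n IH] u; rewrite iterS IH -BB.
by rewrite [iter n.+1 B u]iterSr !iterS -!iterSr.
Qed.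

Let c k u : R := re (dot (iter k A u) u).
Let cE k u : c k u = nrm (iter k B u) ^+ 2.
Proof. by rewrite /c iterA selfadj_iter // nrm2. Qed.
Let c_ge0 k u : 0 <= c k u. Proof. by rewrite cE sqr_ge0. Qed.
Let c_decr k u : c k.+1 u <= c k u.
Proof. by rewrite !cE ler_pXn2r ?nnegrE ?nrm_ge0 //; exact: contraction_B. Qed.
Let c_le j k u : c (j + k) u <= c k u.
Proof. by elim: j => [//|j IH]; apply: le_trans IH; exact: c_decr. Qed.
Let dot_iterA j k u : re (dot (iter j A u) (iter k A u)) = c (j + k) u.
Proof. by rewrite /c -selfadj_iter // -iterD addnC. Qed.

(** The partial sums of the Neumann series of [Rop ^ -1 = (1 - A) ^ -1]. *)
Let p n u := \sum_(0 <= k < n) iter k A u.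

Let R_p n u : Rop (p n u) = u - iter n A u.
Proof.
elim: n => [|n IH]; first by rewrite /p big_nil subrr selfadj0.
rewrite /p big_nat_recr //= selfadjD // IH; set x := iter n A u.
by rewrite [A x]/(x - Rop x) opprB addrA addrAC.
Qed.

Let pB m n u : (m <= n)%N -> p n u - p m u = \sum_(m <= k < n) iter k A u.
Proof.
by move=> mn; rewrite /p (big_cat_nat (leq0n m) mn) /= addrAC subrr add0r.
Qed.

(** [D ^ 2 = Rop A], and [Rop] telescopes the sum of the powers of [A]; so the
    increments are tails of a convergent series. *)
Let nrm2_DpB m n u : (m <= n)%N ->
  nrm (D (p n u - p m u)) ^+ 2 <= \sum_(m <= l < n) c l.+1 u.
Proof.
move=> mn; rewrite nrm2_D /rA -AR selfadjB // !R_p.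
have -> : u - iter n A u - (u - iter m A u) = iter m A u - iter n A u.
  by rewrite opprB addrC subrKA.
rewrite selfadjB // -!iterS pB // dot_sumr re_sum; apply: ler_sum => l _.
rewrite dotBl reB !dot_iterA.
have := c_ge0 (n.+1 + l) u; have := c_le m l.+1 u; rewrite addnS; lra.
Qed.

(** With [g = p n u] and [S = <p n u, u>], the bound of [<u, g> ^ 2] by
    [G u * <Rop g, g>] reads [S ^ 2 <= G u * S]. *)
Let sum_c_le n s : \sum_(0 <= k < n) c k (w s) <= qf G s.
Proof.
set u := w s; set S := \sum_(_ <= _ < _) _.
have hS : re (dot u (p n u)) = S.
  by rewrite dot_sumr re_sum; apply: eq_bigr => k _; rewrite redotC.
have h := form_bound (p n u) s; rewrite -/u hS R_p in h.
have h2 : re (dot (u - iter n A u) (p n u)) <= S.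
  rewrite dotBl reB hS gerBl dot_sumr re_sum sumr_ge0 // => k _.
  by rewrite dot_iterA.
have [S0|S0] := leP S 0; first by apply: (le_trans S0); exact: posdef_qf_ge0.
rewrite -(ler_pM2r S0) -expr2; apply: (le_trans h).
by rewrite ler_wpM2l ?posdef_qf_ge0.
Qed.

Let sum_cS_le n s : \sum_(0 <= l < n) c l.+1 (w s) <= qf q s.
Proof.
have := sum_c_le n.+1 s; rewrite qfG big_nat_recl //= {1}/c /= -nrm2; lra.
Qed.

Let sum_cS_cauchy s (d : R) : 0 < d -> exists N, forall m n, (N <= m)%N -> (m <= n)%N ->
  \sum_(m <= l < n) c l.+1 (w s) <= d.
Proof.
move=> d0; have h n : \sum_(0 <= l < n) c l.+1 (w s) <= \sum_(0 <= l < n.+1) c l.+1 (w s).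
  by rewrite [leRHS]big_nat_recr //= lerDl c_ge0.
have [N hN] := nondecreasing_cauchy h (fun n => sum_cS_le n s) d0.
exists N => m n hm mn; have := hN n m (leq_trans hm mn) hm.
by rewrite (big_cat_nat (leq0n m) mn) /= addrAC subrr add0r.
Qed.

Let nrm_iterA_small s (d : R) : 0 < d -> exists N, forall n, (N <= n)%N ->
  nrm (iter n A (w s)) <= d.
Proof.
move=> d0; have [|N hN] := @sum_cS_cauchy s (d ^+ 2); first by rewrite exprn_gt0.
exists N.+1 => -[//|n] hn; rewrite -(@ler_pXn2r _ 2) ?nnegrE ?nrm_ge0 ?(ltW d0) //.
rewrite nrm2 dot_iterA; apply: (le_trans (c_le _ _ _)).
by have := hN n n.+1 hn (leqnSn n); rewrite big_nat1.
Qed.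

Let root_vec_ex s : exists l, hcvg (fun n => D (p n (w s))) l.
Proof.
apply: cauchy_hcvg => d d0.
have [|N hN] := @sum_cS_cauchy s (d ^+ 2); first by rewrite exprn_gt0.
exists N => m n; wlog mn : m n / (m <= n)%N.
  by move=> h hm hn; have [/h|/ltnW/h] := leqP m n; [apply|rewrite nrmC; apply].
move=> hm hn; rewrite nrmC -selfadjB //.
rewrite -(@ler_pXn2r _ 2) ?nnegrE ?nrm_ge0 ?(ltW d0) //.
by apply: (le_trans (nrm2_DpB _ mn)); exact: hN.
Qed.

Let a x := projT1 (cid (root_vec_ex [:: (1, x)])).

Let selfadj_p n : selfadj (p n).
Proof.
move=> u v; rewrite dot_suml dot_sumr; apply: eq_bigr => k _; exact: selfadj_iter.
Qed.

Let comb_aP s : hcvg (fun n => D (p n (w s))) (comb a s).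
Proof.
have h n : D (p n (w s)) = \sum_(r <- s) r.1 *: D (p n (e r.2)).
  rewrite /w /comb (@selfadj_sum _ _ (p n)) // (@selfadj_sum _ _ D) //; apply: eq_bigr => r _.
  by rewrite !selfadjZ.
under eq_fun do rewrite h.
apply: hcvg_sum => r; apply: hcvgZ.
have -> : e r.2 = w [:: (1, r.2)] by rewrite /w comb_pt scale1r.
exact: projT2 (cid (root_vec_ex [:: (1, r.2)])).
Qed.

Let nrm2_Dp_le n s : nrm (D (p n (w s))) ^+ 2 <= qf q s.
Proof.
have := nrm2_DpB (w s) (leq0n n); rewrite {2}/p big_nil subr0 => h.
exact: le_trans h (sum_cS_le n s).
Qed.

Let gram_a_le : kle (fun x y => dot (a x) (a y)) q.
Proof.
apply: qf_kle => // [|s]; first exact: posdef_gram.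
rewrite qf_gram; apply: (cvgr_to_le (hcvg_nrm2 (@comb_aP s))).
by apply: nearW => n; exact: nrm2_Dp_le.
Qed.

(** [D A ^ k = B ^ k D B ^ k] because [D] commutes with the root [B] of [A]. *)
Let Dp_form n u : 0 <= dot (D (p n u)) u.
Proof.
rewrite /p selfadj_sum // dot_suml; apply: sumr_ge0 => k _.
have -> : D (iter k A u) = iter k B (D (iter k B u)).
  rewrite iterA; elim: {1 2}k (iter k B u) => [//|j IH] v /=.
  by rewrite DB IH.
rewrite selfadj_iter // ge0_complexE pos_D andbT; apply/eqP.
have := congr1 (@complex.Im R) (dotC (D (iter k B u)) (iter k B u)).
by rewrite -selfadj_D imJ; lra.
Qed.

Let posdef_a : posdef (fun x y => dot (a x) (e y)).
Proof.
apply/posdefP => s; rewrite -dot_comb ge0_complexE.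
have h k := hcvg_dot (hcvgZ k (@comb_aP s)) (hcvg_cst (w s)).
have im0 n : im (dot (D (p n (w s))) (w s)) = 0 by rewrite (ger0_Im (Dp_form _ _)).
apply/andP; split.
  have := h 'i%C; under eq_fun do rewrite dotZl reM /= im0 mul0r mulr0 subrr.
  move=> /(cvg_unique _ (cvg_cst 0)) h0; apply/eqP; rewrite -/w.
  by have := h0 (@Rhausdorff R); rewrite dotZl reM /=; lra.
have := h 1; rewrite scale1r => h1.
apply: (cvgr_to_ge h1); apply: nearW => n; rewrite scale1r.
by have := Dp_form n (w s); rewrite ge0_complexE => /andP[].
Qed.

(** For [g = p n (w s)], the vector [Rop g = w s - A ^ n (w s)] is close to
    [w s] and is approximated by combinations on which [q] is close to
    [<Rop g, g> - |Rop g| ^ 2 = |D g| ^ 2]; semicontinuity of [q'] at [s]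
    applies to these combinations. *)
Let a_greatest (q' : ckernel R J) s : kle q' q ->
  (forall d : R, 0 < d -> exists2 r : R, 0 < r &
     forall t, nrm (w t - w s) <= r -> qf q' s <= qf q' t + d) ->
  qf q' s <= nrm (comb a s) ^+ 2.
Proof.
move=> q'q hs; apply/ler_addgt0Pr => d d0; have [r r0 hr] := hs d d0.
have [|N hN] := @nrm_iterA_small s (r / 2); first by rewrite divr_gt0.
suff h n : (N <= n)%N -> qf q' s - d <= nrm (D (p n (w s))) ^+ 2.
  rewrite -lerBlDr; apply: (cvgr_to_ge (hcvg_nrm2 (@comb_aP s))).
  by exists N => // n; exact: h.
move=> hn; set g := p n (w s); rewrite nrm2_D rA_form.
have hlim : (fun m => qf G (sg g m) - nrm (w (sg g m)) ^+ 2) @ \oo -->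
    re (dot (Rop g) g) - nrm (Rop g) ^+ 2.
  by apply: cvgB; [exact: qf_sg|exact: hcvg_nrm2].
have [|M hM] := (hcvgP _ _).1 (RopP g) (r / 2); first by rewrite divr_gt0.
apply: (cvgr_to_ge hlim); exists M => // m /hM hm /=.
rewrite lerBlDr; apply: (@le_trans _ _ (qf q' (sg g m) + d)).
  apply: hr; apply: (le_trans (nrm_tri _ (Rop g) _)).
  have : nrm (Rop g - w s) <= r / 2 by rewrite R_p addrC addKr nrmN hN.
  lra.
by have := kle_qf (sg g m) q'q; rewrite qfG; lra.
Qed.

(** The Gram kernel of [a] is the regular part of [q], its largest closable
    minorant.  If [T] is the positive operator of that form on [H], then
    [comb a s = T ^ (1/2) (comb e s)], obtained here as the limit of
    [D (p n (comb e s))], since [D = T ^ (1/2) (1 + T) ^ -1] and [p n] tends to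
    [1 + T]. *)
Theorem greatest_regular_part : exists a : J -> H,
  [/\ kle (fun x y => dot (a x) (a y)) q, posdef (fun x y => dot (a x) (e y)) &
   forall (q' : ckernel R J) s, kle q' q ->
    (forall d : R, 0 < d -> exists2 r : R, 0 < r &
       forall t, nrm (comb e t - comb e s) <= r -> qf q' s <= qf q' t + d) ->
    qf q' s <= nrm (comb a s) ^+ 2].
Proof. by exists a; split => //; exact: a_greatest. Qed.

(** The parallel sum of [q] and of the Gram kernel of [e]: the quadratic form
    [s |-> inf_t (q t + |e s - e t| ^ 2)]. *)
Theorem parallel_sum : exists P : ckernel R J,
  [/\ posdef P, kle P q, kle P (fun x y => dot (e x) (e y)) &
   forall s (d : R), 0 < d -> exists t,
     qf q t + nrm (comb e s - comb e t) ^+ 2 <= qf P s + d].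
Proof.
pose P : ckernel R J := fun x y => dot (A (e x)) (e y).
have PE s : form P s s = dot (A (w s)) (w s).
  rewrite -dot_comb; congr dot; rewrite /w /comb selfadj_sum //.
  by apply: eq_bigr => r _; rewrite selfadjZ.
have qPE s : qf P s = nrm (w s) ^+ 2 - re (dot (Rop (w s)) (w s)).
  by rewrite /qf PE dotBl reB -nrm2.
have pP : posdef P.
  apply/posdefP => s; rewrite PE ge0_complexE pos_A andbT; apply/eqP.
  by have := congr1 (@complex.Im R) (dotC (A (w s)) (w s)); rewrite -selfadj_A imJ; lra.
exists P; split => //.
- apply: qf_kle => // s; rewrite qPE.
  have := form_bound (w s) s; rewrite -nrm2 qfG.
  have := posdef_qf_ge0 s pq; have := pos_R (w s); have := sqr_ge0 (nrm (w s)).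
  set r := re _; set n := _ ^+ 2; set Q := qf q s; nra.
- apply: qf_kle => // [|s]; first exact: posdef_gram.
  by rewrite qf_gram qPE gerBl.
move=> s d d0; set g := w s.
have hlim : (fun m => qf G (sg g m) - 2 * re (dot (w (sg g m)) g)) @ \oo -->
    re (dot (Rop g) g) - 2 * re (dot (Rop g) g).
  apply: cvgB; first exact: qf_sg.
  by apply: cvgMl_tmp; exact: hcvg_dot (RopP g) (hcvg_cst g).
have /cvgrPdist_le/(_ d d0)[N _ /(_ N (leqnn N)) /= h] := hlim.
exists (sg g N); move: h; rewrite ler_norml => /andP[h _].
rewrite nrm2 -/w -/g !(dotBl, dotBr) !reB [re (dot g (w _))]redotC.
move: h; rewrite qfG qPE -/g !nrm2; lra.
Qed.
End PolarDecomposition.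

(** * Square-summable functions *)

Section UnorderedSums.
Variables (R : realType) (X : choiceType).
Implicit Types (f g : X -> R[i]) (F : {fset X}).
Local Open Scope fset_scope.
Local Open Scope ring_scope.

Definition is_sum f (l : R[i]) := forall d : R, 0 < d -> exists F0 : {fset X},
  forall F, F0 `<=` F -> normc (\sum_(x <- F) f x - l) <= d.

Lemma has_sumP f l : has_sum f l <-> is_sum f l.
Proof.
have psE F : summability.partial_sum f F = \sum_(x <- F) f x.
  by rewrite /summability.partial_sum big_seq_fsetE.
have PF : ProperFilter (@summability.totally X) := summability.totally_filter.
rewrite /has_sum; split=> [/(@cvgrPdist_le R[i] R[i]^o) h d d0|h].
  have [|F0 _ hF] := h d%:C; first by rewrite ltcR.
  exists F0 => F /hF /=; rewrite psE -normrN opprB absE lecR; exact.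
apply/(@cvgrPdist_le R[i] R[i]^o) => e e0.
have [d d0 ->] : exists2 d : R, 0 < d & e = d%:C.
  by exists (re e); [move: e0; rewrite ltcE => /andP[]|exact/ge0_complexP/ltW].
have [F0 hF] := h d d0; exists F0 => // F /hF /=.
by rewrite psE -normrN opprB absE lecR.
Qed.

Lemma is_sum_uniq f l m : is_sum f l -> is_sum f m -> l = m.
Proof.
move=> hl hm; apply: eq_of_normc_small => d d0.
have [|F1 h1] := hl (d / 2); first by rewrite divr_gt0.
have [|F2 h2] := hm (d / 2); first by rewrite divr_gt0.
have {}h1 := h1 _ (fsubsetUl F1 F2); have {}h2 := h2 _ (fsubsetUr F1 F2).
set S := \sum_(x <- _) _ in h1 h2.
have -> : l - m = - (S - l) + (S - m) by ring.
by apply: (le_trans (le_normcD _ _)); rewrite normcN; lra.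
Qed.

Lemma is_sumD f g l m : is_sum f l -> is_sum g m -> is_sum (fun x => f x + g x) (l + m).
Proof.
move=> hl hm d d0.
have [|F1 h1] := hl (d / 2); first by rewrite divr_gt0.
have [|F2 h2] := hm (d / 2); first by rewrite divr_gt0.
exists (F1 `|` F2) => F; rewrite fsubUset => /andP[/h1 {}h1 /h2 {}h2].
rewrite big_split /= opprD addrACA (le_trans (le_normcD _ _)) //; lra.
Qed.

Lemma is_sumZ f l c : is_sum f l -> is_sum (fun x => c * f x) (c * l).
Proof.
move=> h d d0; have n0 : 0 < normc c + 1 by rewrite ltr_wpDl ?normc_ge0.
have [|F0 hF] := h (d / (normc c + 1)); first by rewrite divr_gt0.
exists F0 => F /hF {}hF; rewrite -mulr_sumr -mulrBr normcM.
apply: (@le_trans _ _ ((normc c + 1) * (d / (normc c + 1)))).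
  by apply: ler_pM; rewrite ?normc_ge0 // lerDl.
by rewrite mulrC divfK // gt_eqF.
Qed.

Lemma is_sum_conj f l : is_sum f l -> is_sum (fun x => (f x)^*) l^*.
Proof.
move=> h d /h[F0 hF]; exists F0 => F /hF.
by rewrite -rmorph_sum -rmorphB normc_conj.
Qed.

Lemma is_sum_re_le f l B : is_sum f l -> (forall F, re (\sum_(x <- F) f x) <= B) -> re l <= B.
Proof.
move=> h hB; apply/ler_addgt0Pr => d /h[F0 /(_ F0 (fsubset_refl _)) h0].
have := hB F0; have := le_trans (abs_re_le_normc _) h0.
by rewrite reB ler_norml => /andP[]; lra.
Qed.

Lemma ler_sum_fsubset (g : X -> R) F F' : (forall x, 0 <= g x) -> F `<=` F' ->
  \sum_(x <- F) g x <= \sum_(x <- F') g x.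
Proof.
move=> g0 /fsubsetP FF'; rewrite [leRHS](big_fsetID _ (fun x => x \in F)) /=.
have -> : [fset x | x in F' & x \in F] = F.
  by apply/fsetP => x; rewrite !inE /=; case: (boolP (x \in F)) => [/FF' ->|]; rewrite ?andbF.
by rewrite lerDl; apply: sumr_ge0.
Qed.

Lemma le_is_sum_re f l F : (forall x, 0 <= re (f x)) -> is_sum f l ->
  re (\sum_(x <- F) f x) <= re l.
Proof.
move=> f0 h; apply/ler_addgt0Pr => d /h[F0 /(_ _ (fsubsetUr F F0)) h0].
have := le_trans (abs_re_le_normc _) h0; rewrite reB ler_norml => /andP[_].
suff : re (\sum_(x <- F) f x) <= re (\sum_(x <- F `|` F0) f x) by lra.
by rewrite !re_sum; apply: ler_sum_fsubset; rewrite ?fsubsetUl.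
Qed.

Lemma is_sum_exists_ge0 (f : X -> R) B : (forall x, 0 <= f x) ->
  (forall F, \sum_(x <- F) f x <= B) -> exists l, is_sum (fun x => (f x)%:C) l.
Proof.
move=> f0 hB; pose S := range (fun F : {fset X} => \sum_(x <- F) f x).
have hs : has_sup S by split; [exists (\sum_(x <- fset0) f x), fset0|exists B => _ [F _ <-]].
exists (sup S)%:C => d d0; have [_ [F0 _ <-] h] := sup_adherent d0 hs.
exists F0 => F hF; rewrite -rmorph_sum -rmorphB normc_real ler_norml.
have h1 : \sum_(x <- F) f x <= sup S by apply: ub_le_sup; [exact: hs.2|exists F].
have := ler_sum_fsubset f0 hF => h2; apply/andP; split; lra.
Qed.

(** Bounded nonnegative families converge to the supremum of their finite sums,
    and [f] is a combination of three of them. *)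
Lemma is_sum_exists f B : (forall F, \sum_(x <- F) normc (f x) <= B) ->
  exists l, is_sum f l.
Proof.
move=> hB.
have pos (h : X -> R) : (forall x, `|h x| <= normc (f x)) ->
    exists l, is_sum (fun x => (normc (f x) + h x)%:C) l.
  move=> hh; apply: (@is_sum_exists_ge0 _ (2 * B)) => [x|F].
    by have := hh x; rewrite ler_norml => /andP[]; lra.
  apply: (@le_trans _ _ (\sum_(x <- F) (2 * normc (f x)))).
    apply: ler_sum => x _; have := hh x; rewrite ler_norml => /andP[]; lra.
  by rewrite -mulr_sumr ler_pM2l.
have [|l0 h0] := pos (fun=> 0); first by move=> x; rewrite normr0 normc_ge0.
have [l1 h1] := pos (fun x => re (f x)) (fun x => abs_re_le_normc (f x)).
have [l2 h2] := pos (fun x => im (f x)) (fun x => abs_im_le_normc (f x)).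
exists (l1 - l0 + 'i%C * (l2 - l0)).
have -> : f = fun x => (normc (f x) + re (f x))%:C + (-1) * (normc (f x) + 0)%:C +
   'i%C * ((normc (f x) + im (f x))%:C + (-1) * (normc (f x) + 0)%:C).
  apply/funext => x; have e (r : R) : normc (f x) + r - (normc (f x) + 0) = r by ring.
  by rewrite !mulN1r -!rmorphB !e -complexE.
rewrite -[- l0]mulN1r.
by apply: is_sumD; [|apply: is_sumZ]; apply: is_sumD => //; apply: is_sumZ.
Qed.

End UnorderedSums.

Section SquareSummable.
Variables (R : realType) (X : choiceType).
Local Open Scope fset_scope.
Local Open Scope ring_scope.

Definition sqsum (f : X -> R[i]) := exists B : R, forall F : {fset X},
  \sum_(x <- F) normc (f x) ^+ 2 <= B.

Lemma normc2D (a b : R[i]) : normc (a + b) ^+ 2 <= 2 * normc a ^+ 2 + 2 * normc b ^+ 2.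
Proof.
rewrite !normc2E reD imD.
have := sqr_ge0 (re a - re b); have := sqr_ge0 (im a - im b); rewrite !sqrrB !sqrrD; lra.
Qed.

Definition l2pred : {pred X -> R[i]^o} := fun f => `[< sqsum f >].

Lemma l2_submod : submod_closed l2pred.
Proof.
split=> [|a f g].
  apply/asboolP; exists 0 => F; rewrite big1 // => x _.
  by rewrite [_ x]/(0 : R[i]) normc0 expr0n.
move=> /asboolP[B hB] /asboolP[B' hB']; apply/asboolP.
exists (2 * (normc a ^+ 2 * B) + 2 * B') => F.
apply: (@le_trans _ _ (2 * (normc a ^+ 2 * \sum_(x <- F) normc (f x) ^+ 2) +
  2 * \sum_(x <- F) normc (g x) ^+ 2)).
  rewrite !mulr_sumr -big_split; apply: ler_sum => x _ /=.
  by apply: le_trans (normc2D _ _) _; rewrite normcM exprMn.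
apply: lerD; rewrite ler_pM2l // ler_wpM2l ?sqr_ge0 //.
Qed.

HB.instance Definition _ := GRing.isSubmodClosed.Build _ _ l2pred l2_submod.

Record l2 := L2 { l2val : X -> R[i]^o; l2valP : l2val \in l2pred }.
HB.instance Definition _ := [isSub for l2val].
HB.instance Definition _ := [Choice of l2 by <:].
HB.instance Definition _ := [SubChoice_isSubLmodule of l2 by <:].

Definition l2coord (f : l2) (x : X) : R[i] := l2val f x.

Lemma coordD f g x : l2coord (f + g) x = l2coord f x + l2coord g x.
Proof. by []. Qed.
Lemma coordZ a f x : l2coord (a *: f) x = a * l2coord f x.
Proof. by []. Qed.
Lemma coord_ext f g : l2coord f =1 l2coord g -> f = g.
Proof. by move=> h; apply: val_inj; apply/funext. Qed.
Lemma coord_sqsum f : sqsum (l2coord f).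
Proof. by have /asboolP := l2valP f. Qed.

Definition l2mk (f : X -> R[i]) (h : sqsum f) : l2 := @L2 f (introT (asboolP _) h).

Lemma l2dot_ex (f g : l2) : exists l, is_sum (fun x => l2coord f x * (l2coord g x)^*) l.
Proof.
have [B hB] := coord_sqsum f; have [B' hB'] := coord_sqsum g.
apply: (@is_sum_exists _ _ _ (B + B')) => F.
apply: (@le_trans _ _ (\sum_(x <- F) normc (l2coord f x) ^+ 2 + \sum_(x <- F) normc (l2coord g x) ^+ 2)).
  rewrite -big_split; apply: ler_sum => x _ /=; rewrite normcM normc_conj.
  have := sqr_ge0 (normc (l2coord f x) - normc (l2coord g x)).
  have := mulr_ge0 (normc_ge0 (l2coord f x)) (normc_ge0 (l2coord g x)).
  rewrite sqrrB; lra.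
exact: lerD.
Qed.

Definition l2dot f g := projT1 (cid (l2dot_ex f g)).
Lemma l2dotP f g : is_sum (fun x => l2coord f x * (l2coord g x)^*) (l2dot f g).
Proof. exact: projT2 (cid (l2dot_ex f g)). Qed.

Lemma l2dotDl f g h : l2dot (f + g) h = l2dot f h + l2dot g h.
Proof.
apply: (is_sum_uniq (l2dotP _ _)).
have := is_sumD (l2dotP f h) (l2dotP g h).
by under eq_fun do rewrite -mulrDl -coordD.
Qed.
Lemma l2dotZl a f h : l2dot (a *: f) h = a * l2dot f h.
Proof.
apply: (is_sum_uniq (l2dotP _ _)).
have := is_sumZ a (l2dotP f h).
by under eq_fun do rewrite mulrA -coordZ.
Qed.
Lemma l2dotC f g : l2dot g f = (l2dot f g)^*.
Proof.
apply: (is_sum_uniq (l2dotP _ _)).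
have := is_sum_conj (l2dotP f g).
by under eq_fun do rewrite rmorphM /= conjCK mulrC.
Qed.

Lemma sum_le_l2dot f (F : {fset X}) :
  \sum_(x <- F) normc (l2coord f x) ^+ 2 <= re (l2dot f f).
Proof.
have := le_is_sum_re F _ (l2dotP f f); rewrite re_sum.
under eq_bigr do rewrite mul_conj /=.
by apply => x; rewrite mul_conj /= sqr_ge0.
Qed.

Lemma l2dot_le f B : (forall F : {fset X}, \sum_(x <- F) normc (l2coord f x) ^+ 2 <= B) ->
  re (l2dot f f) <= B.
Proof.
move=> hB; apply: (is_sum_re_le (l2dotP f f)) => F; rewrite re_sum.
by under eq_bigr do rewrite mul_conj /=.
Qed.

Lemma l2dot_ge0 f : 0 <= re (l2dot f f).
Proof. by have := sum_le_l2dot f fset0; rewrite big_seq_fset0. Qed.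

Lemma normc2_coord_le f x : normc (l2coord f x) ^+ 2 <= re (l2dot f f).
Proof. by have := sum_le_l2dot f [fset x]; rewrite big_seq_fset1. Qed.

Lemma l2dot_eq0 f : re (l2dot f f) = 0 -> f = 0.
Proof.
move=> h; apply: coord_ext => x; apply/eqP; rewrite [l2coord 0 x]/(0 : R[i]).
rewrite -normc_eq0 -sqrf_eq0; apply/eqP/le_anti.
by rewrite sqr_ge0 andbT -h normc2_coord_le.
Qed.

Lemma real_cauchy_cvg (u : nat -> R) :
  (forall e : R, 0 < e -> exists N, forall m n, (N <= m)%N -> (N <= n)%N -> `|u m - u n| <= e) ->
  exists l : R, u @ \oo --> l.
Proof.
move=> h; suff /cvg_ex : cvgn u by []; apply: cauchy_cvg; apply/cauchy_exP => e e0.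
have [|N hN] := h (e / 2); first by rewrite divr_gt0.
exists (u N); exists N => // n hn; rewrite /ball /= /ball_.
by apply: (le_lt_trans (hN N n (leqnn N) hn)); lra.
Qed.

Lemma l2_complete (u : nat -> l2) :
  (forall e : R, 0 < e -> exists N, forall m n, (N <= m)%N -> (N <= n)%N ->
     re (l2dot (u m - u n) (u m - u n)) < e) ->
  exists l, forall e : R, 0 < e -> exists N, forall n, (N <= n)%N ->
     re (l2dot (u n - l) (u n - l)) < e.
Proof.
move=> h.
have hx x (e : R) : 0 < e -> exists N, forall m n, (N <= m)%N -> (N <= n)%N ->
    normc (l2coord (u m) x - l2coord (u n) x) <= e.
  move=> e0; have [|N hN] := h (e ^+ 2); first by rewrite exprn_gt0.
  exists N => m n hm hn; rewrite -(@ler_pXn2r _ 2) ?nnegrE ?normc_ge0 ?(ltW e0) //.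
  exact: le_trans (normc2_coord_le (u m - u n) x) (ltW (hN m n hm hn)).
have cre x : exists l : R, (fun n => re (l2coord (u n) x)) @ \oo --> l.
  apply: real_cauchy_cvg => e /(hx x)[N hN]; exists N => m n hm hn.
  by rewrite -reB (le_trans (abs_re_le_normc _)) ?hN.
have cim x : exists l : R, (fun n => im (l2coord (u n) x)) @ \oo --> l.
  apply: real_cauchy_cvg => e /(hx x)[N hN]; exists N => m n hm hn.
  by rewrite -imN -imD (le_trans (abs_im_le_normc _)) ?hN.
pose f x : R[i] := Complex (projT1 (cid (cre x))) (projT1 (cid (cim x))).
have fP (F : seq X) m : (fun n => \sum_(x <- F) normc (l2coord (u m) x - l2coord (u n) x) ^+ 2) @ \oo
    --> \sum_(x <- F) normc (l2coord (u m) x - f x) ^+ 2.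
  elim: F => [|x F IH].
    by rewrite big_nil; under eq_fun do rewrite big_nil; exact: cvg_cst.
  rewrite big_cons; under eq_fun do rewrite big_cons; apply: cvgD => //.
  rewrite normc2E !(reB, imD, imN); under eq_fun do rewrite normc2E !(reB, imD, imN).
  apply: cvgD; rewrite !expr2; under eq_fun do rewrite expr2.
    by apply: cvgM; apply: cvgB; [exact: cvg_cst|exact: (projT2 (cid (cre x)))
      |exact: cvg_cst|exact: (projT2 (cid (cre x)))].
  by apply: cvgM; apply: cvgB; [exact: cvg_cst|exact: (projT2 (cid (cim x)))
    |exact: cvg_cst|exact: (projT2 (cid (cim x)))].
have hF (e : R) : 0 < e -> exists N, forall m, (N <= m)%N -> forall F : {fset X},
    \sum_(x <- F) normc (l2coord (u m) x - f x) ^+ 2 <= e.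
  move=> /h[N hN]; exists N => m hm F; apply: (cvgr_to_le (@fP (enum_fset F) m)).
  exists N => // n /= hn; apply: le_trans (ltW (hN m n hm hn)).
  exact: (sum_le_l2dot (u m - u n) F).
have sf : sqsum f.
  have [N hN] := hF 1 ltr01; have [B hB] := coord_sqsum (u N).
  exists (2 * B + 2 * 1) => F.
  apply: (@le_trans _ _ (2 * \sum_(x <- F) normc (l2coord (u N) x) ^+ 2 +
     2 * \sum_(x <- F) normc (l2coord (u N) x - f x) ^+ 2)).
    rewrite !mulr_sumr -big_split; apply: ler_sum => x _ /=.
    have := normc2D (l2coord (u N) x) (- (l2coord (u N) x - f x)).
    by rewrite subKr normcN.
  by apply: lerD; rewrite ler_pM2l // hN.
exists (l2mk sf) => e e0; have [|N hN] := hF (e / 2); first by rewrite divr_gt0.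
exists N => n hn; apply: (@le_lt_trans _ _ (e / 2)); last by lra.
by apply: l2dot_le => F; exact: hN.
Qed.

(** These two facts characterize the Hilbert space of square-summable
    functions; nothing else about the concrete model is used afterwards. *)
Lemma l2_space_exists : exists (H : hilbert R) (c : H -> X -> R[i]),
  (forall f g, is_sum (fun x => c f x * (c g x)^*) (dot f g)) /\
  (forall f, sqsum f -> exists h, c h = f).
Proof.
exists (Hilbert l2dotDl l2dotZl l2dotC l2dot_ge0 l2dot_eq0 l2_complete), l2coord.
by split=> [f g|f h]; [exact: l2dotP|exists (l2mk h)].
Qed.

Definition l2H : hilbert R := projT1 (cid l2_space_exists).
Definition coord : l2H -> X -> R[i] := projT1 (cid (projT2 (cid l2_space_exists))).
Lemma dot_is_sum (f g : l2H) : is_sum (fun x => coord f x * (coord g x)^*) (dot f g).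
Proof. by case: (projT2 (cid (projT2 (cid l2_space_exists)))) => h _; exact: h. Qed.
Lemma mkl2_ex (f : X -> R[i]) : sqsum f -> exists h : l2H, coord h = f.
Proof. by case: (projT2 (cid (projT2 (cid l2_space_exists)))) => _; exact. Qed.
Definition mkl2 f (h : sqsum f) : l2H := projT1 (cid (mkl2_ex h)).
Lemma coord_mk f (h : sqsum f) : coord (mkl2 h) = f.
Proof. exact: projT2 (cid (mkl2_ex h)). Qed.
End SquareSummable.

(** * Roots and closable forms *)

Section RootsAndSemicontinuity.
Variables (R : realType) (X : choiceType).
Local Notation H := (l2H R X).
Implicit Types (K L M : ckernel R X) (s t : seq (R[i] * X)).

Lemma is_sum_single (g : X -> R[i]) x : (forall y, y != x -> g y = 0) -> is_sum g (g x).
Proof.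
move=> h d d0; exists [fset x]%fset => F; rewrite fsub1set => xF.
rewrite (bigD1_seq x) //= big1 ?addr0 ?subrr ?normc0 ?ltW //.
Qed.

Lemma delta_sqsum (x : X) : sqsum (fun y => (y == x)%:R : R[i]).
Proof.
exists 1 => F; have [xF|xF] := boolP (x \in F).
  rewrite (bigD1_seq x) //= eqxx normc1 expr1n big1 ?addr0 // => y /negPf ->.
  by rewrite normc0 expr0n.
rewrite big_seq big1 // => y yF; case: eqP xF => [<-|_ _]; first by rewrite yF.
by rewrite normc0 expr0n.
Qed.

Definition ebasis x : H := mkl2 (delta_sqsum x).
Lemma coord_ebasis x y : coord (ebasis x) y = (y == x)%:R.
Proof. by rewrite coord_mk. Qed.

Lemma dot_ebasis (f : H) x : dot f (ebasis x) = coord f x.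
Proof.
apply: (is_sum_uniq (dot_is_sum f (ebasis x))).
have := @is_sum_single (fun y => coord f y * (coord (ebasis x) y)^*) x.
rewrite coord_ebasis eqxx rmorph1 mulr1; apply => y /negPf h.
by rewrite coord_ebasis h rmorph0 mulr0.
Qed.

Local Notation w := (comb ebasis).

Lemma coord_inj (f g : H) : coord f =1 coord g -> f = g.
Proof.
move=> h; apply/subr0_eq/dot_eq0.
have hc : coord (f - g) = fun=> 0.
  by apply/funext => x; rewrite -dot_ebasis dotBl !dot_ebasis h subrr.
have := dot_is_sum (f - g) (f - g); rewrite hc => h1.
have -> : dot (f - g) (f - g) = 0; last by [].
apply: (is_sum_uniq h1) => d d0; exists fset0 => F _.
by rewrite big1 ?subrr ?normc0 ?ltW // => x _; rewrite mul0r.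
Qed.

Lemma nrm2_comb_fset (c : X -> R[i]) (F : {fset X}) :
  nrm (w [seq (c x, x) | x <- F]) ^+ 2 = \sum_(x <- F) normc (c x) ^+ 2.
Proof.
rewrite nrm2 /comb big_map dot_suml re_sum !big_seq; apply: eq_bigr => x xF.
rewrite dotZl dot_sumr -big_seq (bigD1_seq x) //= big1 ?addr0.
  by rewrite dotZr dot_ebasis coord_ebasis eqxx mulr1 mul_conj.
move=> y yx; rewrite dotZr dot_ebasis coord_ebasis (negPf yx) mulr0 //.
Qed.

Lemma finite_support_dense (f : H) (d : R) : 0 < d -> exists s, nrm (f - w s) <= d.
Proof.
move=> d0; have [|F hF] := dot_is_sum f f (d := d ^+ 2); first by rewrite exprn_gt0.
have {hF} := hF F (fsubset_refl F); set S := \sum_(x <- F) _ => hS.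
pose s := [seq (coord f x, x) | x <- F]; exists s.
have cs x : x \in F -> coord (w s : H) x = coord f x.
  move=> xF; rewrite -dot_ebasis /comb dot_suml big_map (bigD1_seq x) //= big1 ?addr0.
    by rewrite dotZl dot_ebasis coord_ebasis eqxx mulr1.
  by move=> y yx; rewrite /= dotZl dot_ebasis coord_ebasis eq_sym (negPf yx) mulr0.
have wg (g : H) : (forall x, x \in F -> coord g x = coord f x) -> dot (w s) g = S.
  move=> hg; rewrite /comb dot_suml big_map /S !big_seq; apply: eq_bigr => x xF.
  by rewrite /= dotZl dotC dot_ebasis hg.
rewrite -(@ler_pXn2r _ 2) ?nnegrE ?nrm_ge0 ?(ltW d0) // nrm2 dotBl !dotBr.
rewrite (dotC (w s) f) !wg // !reB reJ.
have := le_trans (abs_re_le_normc _) hS; rewrite reB ler_norml => /andP[h1 h2].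
lra.
Qed.

Lemma l2_fun_sqsum (f : X -> R[i]) : l2_fun f -> sqsum f.
Proof.
rewrite /l2_fun => h; exists (fine (\esum_(x in [set: X]) (re `|f x| ^+ 2)%:E)) => F.
rewrite -lee_fin fineK; last first.
  by rewrite ge0_fin_numE //; apply: esum_ge0 => x _; rewrite lee_fin sqr_ge0.
apply: esum_ge; exists [set` F]; first by split.
by rewrite fsbig_finite //= set_fsetK sumEFin.
Qed.

(** For a nonnegative quadratic form, lower semicontinuity on its domain is
    equivalent to closability. *)
Definition lsc L := forall s (d : R), 0 < d -> exists2 r : R, 0 < r &
  forall t, nrm (w t - w s) <= r -> qf L s <= qf L t + d.

Lemma root_rows L M : is_pdms_root L M -> exists m : X -> H,
  (forall x y, coord (m x) y = M x y) /\ (forall x z, dot (m x) (m z) = L x z).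
Proof.
move=> [pL pM hM].
have h x z : is_sum (fun y => M x y * (M z y)^*) (L x z).
  have := (has_sumP _ _).1 (hM x z).
  by under eq_fun do rewrite (posdef_conj z _ pM).
have sM x : sqsum (M x).
  exists (re (L x x)) => F; have := le_is_sum_re F _ (h x x); rewrite re_sum.
  under eq_bigr do rewrite mul_conj /=.
  by apply => y; rewrite mul_conj /= sqr_ge0.
exists (fun x => mkl2 (sM x)); split=> [x y|x z]; first by rewrite coord_mk.
apply: (is_sum_uniq (dot_is_sum (mkl2 (sM x)) (mkl2 (sM z)))).
by rewrite !coord_mk.
Qed.

Lemma rows_root L M (m : X -> H) : posdef M ->
  (forall x y, coord (m x) y = M x y) -> (forall x z, dot (m x) (m z) = L x z) ->
  is_pdms_root L M.
Proof.
move=> pM hm hL; have -> : L = fun x z => dot (m x) (m z).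
  by apply/funext => x; apply/funext => z.
split => // [|x z]; first exact: posdef_gram.
apply/has_sumP; have := dot_is_sum (m x) (m z).
by under eq_fun do rewrite !hm -(posdef_conj _ _ pM).
Qed.

Lemma dot_comb_rows M (m : X -> H) s t : posdef M ->
  (forall x y, coord (m x) y = M x y) ->
  dot (comb m s) (w t) = form M s t /\ dot (w s) (comb m t) = form M s t.
Proof.
move=> pM hm; rewrite !dot_comb; split; congr form;
  apply/funext => x; apply/funext => y; first by rewrite dot_ebasis hm.
by rewrite dotC dot_ebasis hm -(posdef_conj _ _ pM).
Qed.

(** [|M g| ^ 2] dominates [2 Re <g, M h> - |h| ^ 2], which is continuous in [g]
    and almost optimal at [s] when [h] is close to [M s]. *)
Lemma root_lower_bound L M (m : X -> H) s g h : posdef M ->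
  (forall x y, coord (m x) y = M x y) -> (forall x z, dot (m x) (m z) = L x z) ->
  2 * re (dot (w g - w s) (comb m h)) + qf L s - nrm (comb m s - w h) ^+ 2 <= qf L g.
Proof.
move=> pM hm hL.
have qL t : qf L t = nrm (comb m t) ^+ 2.
  by rewrite -qf_gram; congr qf; apply/funext => x; apply/funext => z; rewrite hL.
have [e1 e2] := dot_comb_rows g h pM hm; have [e3 e4] := dot_comb_rows s h pM hm.
have := sqr_ge0 (nrm (comb m g - w h)).
by rewrite !qL !nrm2B e1 e3 dotBl reB e2 e4; lra.
Qed.

Lemma root_lsc L M : is_pdms_root L M -> lsc L.
Proof.
move=> hLM; have [_ pM _] := hLM; have [m [hm hL]] := root_rows hLM.
move=> s d d0.
have [|h hh] := finite_support_dense (comb m s) (d := Num.sqrt (d / 2)).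
  by rewrite sqrtr_gt0 divr_gt0.
have hh2 : nrm (comb m s - w h) ^+ 2 <= d / 2.
  rewrite -[leRHS]sqr_sqrtr ?ler_pXn2r ?nnegrE ?nrm_ge0 ?sqrtr_ge0 //.
  by rewrite divr_ge0 // ltW.
exists (d / (4 * (nrm (comb m h) + 1))).
  by rewrite divr_gt0 // mulr_gt0 // ltr_wpDl ?nrm_ge0.
move=> t ht; have k := root_lower_bound s t h pM hm hL.
have k2 := abs_re_dot_small d0 (ltr0Sn R 3) ht.
move: k2; rewrite ler_norml => /andP[k2 k3]; lra.
Qed.

Lemma lsc_root L : posdef L -> lsc L -> has_pdms_root L.
Proof.
move=> pL hL; have [a [h1 h2 h3]] := greatest_regular_part ebasis pL.
exists (fun x y => coord (a x) y); apply: (@rows_root _ _ a) => //.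
  by move: h2; congr posdef; apply/funext => x; apply/funext => y; rewrite dot_ebasis.
have : (fun x y => dot (a x) (a y)) = L; last by move=> <-.
apply: kle_anti => //; apply: qf_kle => // [|s]; first exact: posdef_gram.
rewrite qf_gram; apply: h3; last exact: hL.
by apply: qf_kle.
Qed.

(** If the form is closable then it is its own regular part, and the vectors
    [a x] whose Gram kernel it is are the rows of a root. *)
Theorem has_root_lsc L : has_pdms_root L <-> posdef L /\ lsc L.
Proof.
split=> [[M hM]|[]]; last exact: lsc_root.
by split; [case: hM|exact: root_lsc hM].
Qed.
End RootsAndSemicontinuity.

(** * Permanence of lower semicontinuity *)

Section LscStability.
Variables (R : realType).

Lemma lsc0 (X : choiceType) : lsc (fun _ _ : X => 0 : R[i]).
Proof.
move=> s d d0; exists 1 => // t _; rewrite /qf.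
have h0 u v : form (fun _ _ : X => 0 : R[i]) u v = 0.
  by rewrite /form big1 // => p _; rewrite big1 // => r _; rewrite mulr0.
by rewrite !h0 lerDl ltW.
Qed.

Lemma lscD (X : choiceType) (K L : ckernel R X) : lsc K -> lsc L ->
  lsc (fun x y => K x y + L x y).
Proof.
move=> hK hL s d d0; have d2 : 0 < d / 2 by rewrite divr_gt0.
have [r r0 hr] := hK s _ d2; have [r' r'0 hr'] := hL s _ d2.
exists (Num.min r r'); first by rewrite lt_min r0.
move=> t; rewrite le_min => /andP[/hr h1 /hr' h2]; rewrite !qf_kernelD; lra.
Qed.

Lemma lsc_approx (X : choiceType) (K : ckernel R X) :
  (forall s (d : R), 0 < d -> exists L, [/\ lsc L, forall t, qf L t <= qf K t &
    qf K s <= qf L s + d]) -> lsc K.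
Proof.
move=> h s d d0; have d2 : 0 < d / 2 by rewrite divr_gt0.
have [L [hL LK hs]] := h s _ d2; have [r r0 hr] := hL s _ d2.
by exists r => // t /hr; have := LK t; lra.
Qed.

(** Partial maps are allowed so that restriction to a subset, multiplication by
    a bounded function and extension by zero are all instances. *)
Section Pullback.
Variables (Y X : choiceType) (K : ckernel R X) (u : Y -> R[i]) (f : Y -> option X).

Definition kernel_option (o o' : option X) : R[i] :=
  if o is Some x then if o' is Some x' then K x x' else 0 else 0.
Definition pullback : ckernel R Y :=
  fun y y' => u y * (u y')^* * kernel_option (f y) (f y').
Definition push (s : seq (R[i] * Y)) : seq (R[i] * X) :=
  pmap (fun p => omap (fun x => (p.1 * u p.2, x)) (f p.2)) s.

Lemma big_pmap_option (I : Type) (g : I -> option (R[i] * X)) (F : R[i] * X -> R[i]) (s : seq I) :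
  \sum_(p <- pmap g s) F p = \sum_(i <- s) oapp F 0 (g i).
Proof.
elim: s => [|i s IH]; first by rewrite !big_nil.
by rewrite big_cons /= -IH; case: (g i) => [p|] /=; rewrite ?big_cons ?add0r.
Qed.

Lemma form_push s t : form K (push s) (push t) = form pullback s t.
Proof.
rewrite /form /push big_pmap_option; apply: eq_bigr => p _.
rewrite /pullback; case: (f p.2) => [x|] /=; last first.
  by rewrite big1 // => r _; rewrite !mulr0.
rewrite big_pmap_option; apply: eq_bigr => r _.
by case: (f r.2) => [x'|] /=; rewrite ?rmorphM /=; ring.
Qed.
Lemma qf_push s : qf K (push s) = qf pullback s.
Proof. by rewrite /qf form_push. Qed.
Lemma posdef_pullback : posdef K -> posdef pullback.
Proof. by move=> /posdefP h; apply/posdefP => s; rewrite -form_push. Qed.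

Lemma push_sub s t : push (sub_seq s t) = sub_seq (push s) (push t).
Proof.
rewrite /push /sub_seq pmap_cat; congr (_ ++ _); rewrite /scl.
elim: t => [//|p t IH] /=; case: (f p.2) => [x|] //=.
by rewrite mulrA IH.
Qed.
End Pullback.

Lemma nrm2_comb_ebasis (X : choiceType) (s : seq (R[i] * X)) :
  nrm (comb (@ebasis R X) s) ^+ 2 = qf (fun x y => (x == y)%:R) s.
Proof.
by rewrite -qf_gram; congr qf; apply/funext => x; apply/funext => y; rewrite dot_ebasis coord_ebasis eq_sym.
Qed.

Lemma posdef_diag (X : choiceType) (d : X -> R) : (forall x, 0 <= d x) ->
  posdef (fun x y : X => (d x)%:C * (x == y)%:R).
Proof.
move=> d0; have := posdef_gram (fun x : X => (Num.sqrt (d x))%:C *: (@ebasis R X x : l2H R X)).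
congr posdef; apply/funext => x; apply/funext => y.
rewrite dotZl dotZr dot_ebasis coord_ebasis eq_sym conj_real mulrA -rmorphM /=.
by case: eqP => [->|_]; rewrite ?mulr0 // -expr2 sqr_sqrtr.
Qed.

(** Since [f] is injective where it is defined, the difference of the two
    kernels of squared norms is diagonal, with nonnegative entries. *)
Lemma nrm_push_le (Y X : choiceType) (u : Y -> R[i]) (f : Y -> option X) (c : R) s :
  0 <= c -> (forall y, normc (u y) <= c) ->
  (forall y y' x, f y = Some x -> f y' = Some x -> y = y') ->
  nrm (comb (@ebasis R X) (push u f s)) <= c * nrm (comb (@ebasis R Y) s).
Proof.
move=> c0 uc finj; rewrite -(@ler_pXn2r _ 2) ?nnegrE ?mulr_ge0 ?nrm_ge0 //.
rewrite exprMn !nrm2_comb_ebasis qf_push -qf_kscale; apply: kle_qf.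
pose d y := c ^+ 2 - (if f y is Some _ then normc (u y) ^+ 2 else 0).
have d0 y : 0 <= d y.
  rewrite /d; case: (f y) => [_|]; last by rewrite subr0 sqr_ge0.
  by rewrite subr_ge0 ler_pXn2r ?nnegrE ?normc_ge0.
have := posdef_diag d0; congr posdef; apply/funext => y; apply/funext => y'.
rewrite /kscale /pullback /kernel_option /d.
case: eqP => [<-|ne]; rewrite ?mulr1 ?mulr0 ?sub0r.
  by case: (f y) => [x|]; rewrite ?eqxx ?mulr1 ?mulr0 ?subr0 // mul_conj -rmorphB.
case fy : (f y) => [x|]; last by rewrite mulr0 oppr0.
case fy' : (f y') => [x'|]; last by rewrite mulr0 oppr0.
case: eqP => [e|]; last by rewrite mulr0 oppr0.
by rewrite -e in fy'; have := finj _ _ _ fy fy'.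
Qed.

Lemma lsc_pullback (Y X : choiceType) (K : ckernel R X) (u : Y -> R[i]) (f : Y -> option X) (c : R) :
  (forall y, normc (u y) <= c) ->
  (forall y y' x, f y = Some x -> f y' = Some x -> y = y') ->
  lsc K -> lsc (pullback K u f).
Proof.
move=> uc finj hK s d d0; have [r r0 hr] := hK (push u f s) d d0.
have c0 : 0 < `|c| + 1 by rewrite ltr_wpDl.
exists (r / (`|c| + 1)); first by rewrite divr_gt0.
move=> t ht; rewrite -!qf_push; apply: hr.
rewrite -comb_sub -push_sub; apply: le_trans.
  apply: (@nrm_push_le _ _ _ _ (`|c| + 1)) => [||]; [exact: ltW| |exact: finj].
  by move=> y; apply: (le_trans (uc y)); apply: (le_trans (ler_norm _)); rewrite lerDl.
by rewrite comb_sub mulrC -ler_pdivlMr.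
Qed.

(** [K t >= 2 Re K(t, s) - K s], and [K(., s)] is continuous because the rows
    are square-summable. *)
Lemma lsc_continuous_rows (X : choiceType) (K : ckernel R X) : posdef K ->
  (forall x, sqsum (K x)) -> lsc K.
Proof.
move=> pK sK; pose k x : l2H R X := mkl2 (sK x) => s d d0.
have hk x y : coord (k x) y = K x y by rewrite coord_mk.
exists (d / (2 * (nrm (comb k s) + 1))).
  by rewrite divr_gt0 // mulr_gt0 // ltr_wpDl ?nrm_ge0.
move=> t ht.
have [_ e1] := @dot_comb_rows _ _ K k t s pK hk.
have [_ e2] := @dot_comb_rows _ _ K k s s pK hk.
have := posdef_qf_ge0 (sub_seq t s) pK; rewrite qf_sub //.
have := abs_re_dot_small d0 (ltr0Sn R 1) ht.
rewrite dotBl reB e1 e2 ler_norml -[re (form K s s)]/(qf K s) => /andP[]; lra.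
Qed.

(** Lower semicontinuity is the same as closability, which depends on the form
    only up to equivalence.  Near-minimizers of [L] in a small ball around [s]
    are close to each other for [L] by the parallelogram law, hence for [K];
    semicontinuity of [K] then makes them close to [s] itself. *)
Lemma lsc_equivalent (X : choiceType) (K L : ckernel R X) (c1 c2 : R) :
  posdef K -> posdef L -> 0 < c1 -> 0 < c2 -> kle (kscale c1 K) L -> kle L (kscale c2 K) ->
  lsc K -> lsc L.
Proof.
move=> pK pL c10 c20 h1 h2 hK s.
pose w := comb (@ebasis R X).
(* The supremum of [E] is the limit, as the radius shrinks, of the infimum of
   the form of [L] over the balls around [s]. *)
pose E := [set x : R | exists2 r : R, 0 < r & forall t, nrm (w t - w s) <= r -> x <= qf L t].
have hs : has_sup E.
  split; first by exists 0, 1 => // t _; exact: posdef_qf_ge0.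
  by exists (qf L s) => x [r r0 /(_ s)]; apply; rewrite subrr nrm0 ltW.
set D := sup E.
suff hD : qf L s <= D.
  move=> d d0; have [x [r r0 hx] hxd] := sup_adherent d0 hs.
  by rewrite -/D in hxd; exists r => // t /hx; lra.
have D0 : 0 <= D by apply: ub_le_sup; [exact: hs.2|exists 1 => // t _; exact: posdef_qf_ge0].
have near r h : 0 < r -> 0 < h -> exists2 t, nrm (w t - w s) <= r & qf L t <= D + h.
  move=> r0 h0; apply: contrapT => hn.
  suff : D + h <= D by lra.
  apply: ub_le_sup; first exact: hs.2.
  exists r => // t ht; rewrite leNgt; apply/negP => lt; apply: hn.
  by exists t => //; exact: ltW.
have close h : 0 < h -> exists2 t, qf L t <= D + h & qf L (sub_seq s t) <= c2 * (8 / c1 + 1) * h.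
  move=> h0; have [x [r0 r00 hx] hxD] := sup_adherent h0 hs; rewrite -/D in hxD.
  have [t tr tD] := near r0 h r00 h0; exists t => //.
  have [r r_gt0 hr] := hK (sub_seq s t) h h0.
  have [|t' t'r t'D] := near (Num.min r r0) h _ h0; first by rewrite lt_min r_gt0.
  move: t'r; rewrite le_min => /andP[t'r t'r0].
  pose m := scl (2^-1)%:C (t ++ t').
  have wm : w m = (2^-1)%:C *: (w t + w t') by rewrite /w comb_scl comb_cat.
  have hm : D - h < qf L m.
    apply: (lt_le_trans hxD); apply: hx.
    have -> : w m - w s = (2^-1)%:C *: ((w t - w s) + (w t' - w s)).
      rewrite wm addrACA -opprD scalerBr; congr (_ - _).
      rewrite -[w s in RHS]scale1r -scalerDl scalerA -(rmorph1 (real_complex R)) -rmorphD -rmorphM /=.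
      by rewrite (_ : 2^-1 * (1 + 1) = 1) ?scale1r //; lra.
    rewrite nrmZ normc_real ger0_norm ?invr_ge0 //.
    have := nrmD (w t - w s) (w t' - w s); lra.
  have hp : qf L (sub_seq t' t) <= 8 * h.
    move: hm; rewrite qf_sub // /m qf_scl normc_real ger0_norm ?invr_ge0 // qf_cat //.
    rewrite (form_conj _ _ pL) reJ; lra.
  have hp' : qf K (sub_seq t' t) <= 8 / c1 * h.
    rewrite -(ler_pM2l c10); have := kle_qf (sub_seq t' t) h1; rewrite qf_kscale.
    have -> : c1 * (8 / c1 * h) = 8 * h by field; rewrite gt_eqF.
    lra.
  have hKs : qf K (sub_seq s t) <= (8 / c1 + 1) * h.
    rewrite mulrDl mul1r; apply: (le_trans (hr (sub_seq t' t) _)); last by rewrite lerD2r.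
    by rewrite !comb_sub opprB addrA subrK.
  apply: (le_trans (kle_qf _ h2)); rewrite qf_kscale -mulrA.
  by rewrite ler_pM2l.
(* [L s <= (1 + a) L t + (1 + 1 / a) L (s - t)]; first [a] is chosen small,
   and then the distance [h] small with respect to [a]. *)
apply/ler_addgt0Pr => d d0.
pose C := c2 * (8 / c1 + 1).
have C0 : 0 < C by rewrite mulr_gt0 // addr_gt0 // divr_gt0.
pose a := d / (4 * (D + 1)).
have D1 : 0 < 4 * (D + 1) by lra.
have a0 : 0 < a by rewrite divr_gt0.
have aD : a * (D + 1) = d / 4 by rewrite /a; field; lra.
have CC0 : 0 < (1 + a^-1) * C by rewrite mulr_gt0 // addr_gt0 // invr_gt0.
pose h := Num.min 1 (Num.min (d / 4) (d / 4 / ((1 + a^-1) * C))).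
have h0 : 0 < h by rewrite !lt_min ltr01 !divr_gt0.
have h_1 : h <= 1 by rewrite /h !ge_min lexx.
have h_2 : h <= d / 4 by rewrite /h !ge_min lexx orbT.
have h_3 : (1 + a^-1) * (C * h) <= d / 4.
  by rewrite mulrA mulrC -ler_pdivlMr // /h !ge_min lexx !orbT.
have [t tD tC] := close h h0.
have hq : qf L s <= (1 + a) * qf L t + (1 + a^-1) * qf L (sub_seq s t).
  have := posdef_qf_ge0 (sub_seq (scl (a)%:C t) (sub_seq s t)) pL.
  rewrite [qf L (sub_seq (scl _ _) _)]qf_sub // qf_scl form_scll reZ normc_real ger0_norm ?(ltW a0) //.
  rewrite /sub_seq form_catr form_sclr rmorphN rmorph1 mulN1r reB -/(sub_seq s t) -[re (form L t t)]/(qf L t) => k.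
  have k2 := qf_sub s t pL.
  rewrite (form_conj t s pL) reJ in k2.
  rewrite -(ler_pM2l a0) [leRHS](_ : _ = a * (1 + a) * qf L t + (a + 1) * qf L (sub_seq s t)); last first.
    by field; rewrite gt_eqF.
  have k3 : a * qf L (sub_seq s t) = a * (qf L s - 2 * re (form L t s) + qf L t) by rewrite k2.
  rewrite k2 in k *; nra.
have e1 : (1 + a) * qf L t <= (1 + a) * (D + h) by rewrite ler_pM2l //; lra.
have e2 : (1 + a^-1) * qf L (sub_seq s t) <= (1 + a^-1) * (C * h).
  by rewrite ler_pM2l // addr_gt0 // invr_gt0.
have e3 : a * (D + h) <= a * (D + 1) by rewrite ler_pM2l // lerD2l.
lra.
Qed.

End LscStability.

(** * Existence of roots *)

Section Parts.
Variables (R : realType) (X : choiceType).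
Implicit Types (K L M : ckernel R X).

Lemma posdef_krestrict (A : set X) K : posdef K -> posdef (krestrict A K).
Proof. by move=> h n x l n0; apply: h. Qed.

Lemma krestrict_pullback (A : set X) K :
  krestrict A K = pullback K (fun=> 1) (fun x : A => Some (val x)).
Proof.
by apply/funext => x; apply/funext => y; rewrite /pullback rmorph1 !mul1r.
Qed.

Lemma root_krestrict (A : set X) K : has_pdms_root K -> has_pdms_root (krestrict A K).
Proof.
move=> /has_root_lsc[pK lK]; apply/has_root_lsc; split.
  exact: posdef_krestrict.
rewrite krestrict_pullback; apply: (@lsc_pullback _ _ _ _ _ _ 1) => //.
  by move=> y; rewrite normc1.
by move=> y y' x [<-] [] /val_inj.
Qed.

Lemma root_multiplier K (u : X -> R[i]) (c : R) : (forall x, `|u x| <= c%:C) ->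
  has_pdms_root K -> has_pdms_root (fun x y => (u x)^* * u y * K x y).
Proof.
move=> hu /has_root_lsc[pK lK]; apply/has_root_lsc.
have -> : (fun x y => (u x)^* * u y * K x y) = pullback K (fun x => (u x)^*) Some.
  by apply/funext => x; apply/funext => y; rewrite /pullback conjCK.
split; first exact: posdef_pullback.
apply: (@lsc_pullback _ _ _ _ _ _ c) => //.
  by move=> y; rewrite normc_conj -lecR -absE.
by move=> y y' x [->] [->].
Qed.

Lemma sqrtC_real (r : R) : 0 <= r -> sqrtC (r%:C) = (Num.sqrt r)%:C :> R[i].
Proof.
move=> r0; apply/eqP; rewrite -(@eqrXn2 _ 2) ?sqrtC_ge0 ?ler0c ?sqrtr_ge0 //.
by rewrite sqrtCK -rmorphXn /= sqr_sqrtr.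
Qed.

Lemma root_kbd K : has_pdms_root K -> has_pdms_root (kbd K).
Proof.
move=> hK; have [pK _] := (has_root_lsc _).1 hK.
pose k x := re (K x x).
have Kxx x : K x x = (k x)%:C.
  apply: ge0_complexP; have /posdefP/(_ [:: (1, x)]) := pK.
  by rewrite form_pt mul1r rmorph1 mul1r.
pose r x := Num.max (k x) 1.
have r1 x : 1 <= r x by rewrite le_max lexx orbT.
have r0 x : 0 < r x by apply: lt_le_trans (r1 x).
have maxE x : Num.max (K x x) 1 = (r x)%:C.
  rewrite Kxx /r /Order.max -(rmorph1 (real_complex R)) /= ltcR.
  by case: ifP.
pose u x := ((Num.sqrt (r x))^-1)%:C.
have -> : kbd K = fun x y => (u x)^* * u y * K x y.
  apply/funext => x; apply/funext => y; rewrite /kbd !maxE -rmorphM /= sqrtC_real; last first.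
    by rewrite mulr_ge0 // ltW.
  rewrite sqrtrM ?(ltW (r0 x)) // /u conj_real -rmorphM /= -invfM.
  by rewrite mulrC fmorphV.
apply: (@root_multiplier _ _ 1) => // x; rewrite absE normc_real lecR ger0_norm.
  rewrite invf_le1 ?sqrtr_gt0 //; apply: le_trans (ler_wsqrtr (r1 x)).
  by rewrite sqrtr1.
by rewrite invr_ge0 sqrtr_ge0.
Qed.

(** Both the row [m x] and its image under the root are norm-close to finitely
    supported vectors; off the support of the latter only the errors remain. *)
Lemma root_c0 K : kbounded K -> has_pdms_root K -> forall (x : X) (e : R), 0 < e ->
  exists2 F : set X, finite_set F & forall y, ~ F y -> `|K x y| < e%:C.
Proof.
move=> [c hc] [M hM] x e e0; have [_ pM _] := hM.
have [m [hm hL]] := root_rows hM.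
pose b := Num.sqrt c.
have mb y : nrm (m y) <= b.
  rewrite /nrm hL; apply: ler_wsqrtr; apply: (le_trans (re_le_normc _)).
  by rewrite -lecR -absE.
have b0 : 0 < b + 1 by rewrite ltr_wpDl ?sqrtr_ge0.
have [|h hh] := finite_support_dense (m x) (d := e / 3 / (b + 1)); first by rewrite !divr_gt0.
have [|h' hh'] := finite_support_dense (comb m h) (d := e / 3); first by rewrite divr_gt0.
exists [set` [seq p.2 | p <- h']] => [|y hy]; first exact: finite_seq.
rewrite absE ltcR -hL -(subrK (comb (@ebasis R X) h) (m x)) dotDl.
apply: (le_lt_trans (le_normcD _ _)).
have h1 : normc (dot (m x - comb (@ebasis R X) h) (m y)) <= e / 3.
  apply: (le_trans (cauchy_schwarz _ _)).
  apply: (@le_trans _ _ (e / 3 / (b + 1) * (b + 1))); last by rewrite divfK // gt_eqF.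
  by apply: ler_pM; rewrite ?nrm_ge0 // (le_trans (mb y)) // lerDl.
have h2 : normc (dot (comb (@ebasis R X) h) (m y)) <= e / 3.
  have -> : dot (comb (@ebasis R X) h) (m y) = dot (comb m h - comb (@ebasis R X) h') (@ebasis R X y).
    have [e1 e2] := dot_comb_rows h [:: (1, y)] pM hm.
    rewrite !comb_pt !scale1r in e1 e2; rewrite e2 dotBl e1.
    rewrite [X in _ - X](_ : _ = 0) ?subr0 // /comb dot_suml big_seq big1 // => p ph'.
    rewrite dotZl dot_ebasis coord_ebasis; case: eqP => [yp|]; last by rewrite mulr0.
    by case: hy; rewrite yp /=; apply: map_f.
  apply: (le_trans (cauchy_schwarz _ _)); apply: le_trans hh'.
  rewrite ler_piMr ?nrm_ge0 // /nrm dot_ebasis coord_ebasis eqxx.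
  by rewrite sqrtr1.
lra.
Qed.

Lemma root_l2_kernel K : posdef K -> l2_kernel K -> has_pdms_root K.
Proof.
move=> pK hK; apply: lsc_root => //; apply: lsc_continuous_rows => // x.
exact/l2_fun_sqsum/(hK x).1.
Qed.

Lemma root_of_root L M : is_pdms_root L M -> has_pdms_root M.
Proof.
move=> hM; have [_ pM _] := hM; have [m [hm _]] := root_rows hM.
apply: lsc_root => //; apply: lsc_continuous_rows => // x.
have [h hx] : exists h : l2H R X, coord h = M x by exists (m x); apply/funext => y.
have h2 := dot_is_sum h h; rewrite hx in h2.
exists (re (dot h h)) => F; have := le_is_sum_re F _ h2; rewrite re_sum.
under eq_bigr do rewrite mul_conj /=.
by apply => y; rewrite mul_conj /= sqr_ge0.
Qed.

Section Nets.
Variables (Sigma : Type) (le : Sigma -> Sigma -> Prop).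
Hypothesis dir : directed le.

Definition net_cvg (f : Sigma -> R[i]) l := forall d : R, 0 < d ->
  exists i, forall j, le i j -> normc (f j - l) <= d.

Lemma tails_net_cvg (f : Sigma -> R[i]) (l : R[i]) :
  f @ tails le --> (l : R[i]^o) -> net_cvg f l.
Proof.
move=> h d d0; have /h[i _ hi] : nbhs (l : R[i]^o) [set z : R[i] | normc (z - l) <= d].
  apply/nbhs_ballP; exists d%:C; first by rewrite /= ltcR.
  move=> z; rewrite -ball_normE /= absE ltcR => /ltW.
  by rewrite -normcN opprB.
by exists i => j /hi.
Qed.

Lemma net_cvgD f g l m : net_cvg f l -> net_cvg g m -> net_cvg (fun i => f i + g i) (l + m).
Proof.
move=> hf hg d d0; have d2 : 0 < d / 2 by rewrite divr_gt0.
have [i hi] := hf _ d2; have [j hj] := hg _ d2.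
case: dir => _ _ tr dj; have [k ik jk] := dj i j.
exists k => n kn; rewrite opprD addrACA (le_trans (le_normcD _ _)) //.
have := hi n (tr _ _ _ ik kn); have := hj n (tr _ _ _ jk kn); lra.
Qed.

Lemma net_cvgZ c f l : net_cvg f l -> net_cvg (fun i => c * f i) (c * l).
Proof.
move=> h d d0; have n0 : 0 < normc c + 1 by rewrite ltr_wpDl ?normc_ge0.
have [|i hi] := h (d / (normc c + 1)); first by rewrite divr_gt0.
exists i => j /hi hj; rewrite -mulrBr normcM.
apply: (@le_trans _ _ ((normc c + 1) * (d / (normc c + 1)))).
  by apply: ler_pM; rewrite ?normc_ge0 // lerDl.
by rewrite mulrC divfK // gt_eqF.
Qed.

Lemma net_cvg_sum (I : Type) (s : seq I) (F : I -> Sigma -> R[i]) (l : I -> R[i]) :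
  (forall i, net_cvg (F i) (l i)) ->
  net_cvg (fun j => \sum_(i <- s) F i j) (\sum_(i <- s) l i).
Proof.
move=> h; elim: s => [|i s IH].
  move=> d d0; case: dir => -[j] _ _ _; exists j => k _.
  by rewrite !big_nil subrr normc0 ltW.
by rewrite big_cons; under eq_fun do rewrite big_cons; exact: net_cvgD.
Qed.

(** The form of the limit is the supremum of an increasing family of forms. *)
Lemma lsc_increasing_net (K_ : Sigma -> ckernel R X) K :
  (forall i j, le i j -> kle (K_ i) (K_ j)) -> kernel_net_cvg le K_ K ->
  (forall i, lsc (K_ i)) -> lsc K.
Proof.
move=> mon cvg hl.
have hc s : net_cvg (fun i => form (K_ i) s s) (form K s s).
  apply: net_cvg_sum => p; apply: net_cvg_sum => r; apply: net_cvgZ.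
  exact: tails_net_cvg.
have hre s (d : R) : 0 < d -> exists i, forall j, le i j -> `|qf (K_ j) s - qf K s| <= d.
  move=> /(hc s)[i hi]; exists i => j /hi.
  by rewrite /qf -reB; apply: le_trans; exact: abs_re_le_normc.
have hle i t : qf (K_ i) t <= qf K t.
  apply/ler_addgt0Pr => d /(hre t)[j hj].
  case: dir => _ _ _ /(_ i j)[k ik jk].
  have := kle_qf t (mon _ _ ik); have := hj k jk; rewrite ler_norml => /andP[]; lra.
apply: lsc_approx => s d /(hre s)[i hi]; exists (K_ i); split => //.
case: dir => _ rf _ _; have := hi i (rf i); rewrite ler_norml => /andP[]; lra.
Qed.
End Nets.

Lemma lsc_sum (S : Type) (s : seq S) (K_ : S -> ckernel R X) : (forall i, lsc (K_ i)) ->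
  lsc (fun x y => \sum_(i <- s) K_ i x y).
Proof.
move=> h; elim: s => [|i s IH].
  have -> : (fun x y => \sum_(i <- [::]) K_ i x y) = fun _ _ => 0.
    by apply/funext => x; apply/funext => y; rewrite big_nil.
  exact: lsc0.
have -> : (fun x y => \sum_(j <- i :: s) K_ j x y) = fun x y => K_ i x y + \sum_(j <- s) K_ j x y.
  by apply/funext => x; apply/funext => y; rewrite big_cons.
exact: lscD.
Qed.

Lemma form_sum (S : Type) (b : seq S) (K_ : S -> ckernel R X) s t :
  form (fun x y => \sum_(i <- b) K_ i x y) s t = \sum_(i <- b) form (K_ i) s t.
Proof.
rewrite /form [RHS]exchange_big; apply: eq_bigr => p _; rewrite [RHS]exchange_big.
by apply: eq_bigr => r _; rewrite mulr_sumr.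
Qed.

Lemma posdef_sum (S : Type) (b : seq S) (K_ : S -> ckernel R X) :
  (forall i, posdef (K_ i)) -> posdef (fun x y => \sum_(i <- b) K_ i x y).
Proof.
move=> h; apply/posdefP => s; rewrite form_sum; apply: sumr_ge0 => i _.
by have /posdefP := h i.
Qed.

Lemma root_sum (S : choiceType) (K_ : S -> ckernel R X) K : posdef K ->
  (forall s, has_pdms_root (K_ s)) ->
  (forall x y, has_sum (fun s => K_ s x y) (K x y)) -> has_pdms_root K.
Proof.
move=> pK hr hs; apply: lsc_root => //.
have lK i : lsc (K_ i) by have [] := (has_root_lsc _).1 (hr i).
have pK_ i : posdef (K_ i) by have [] := (has_root_lsc _).1 (hr i).
have psE F : (fun x y => summability.partial_sum (fun s => K_ s x y) F) =
    fun x y => \sum_(i <- enum_fset F) K_ i x y.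
  by apply/funext => x; apply/funext => y; rewrite /summability.partial_sum big_seq_fsetE.
pose le (A B : {fset S}) : Prop := (A `<=` B)%fset.
have dir : directed le.
  split; first exact: (inhabits fset0).
  - exact: fsubset_refl.
  - by move=> A B C; exact: fsubset_trans.
  - by move=> A B; exists (A `|` B)%fset; [exact: fsubsetUl|exact: fsubsetUr].
apply: (@lsc_increasing_net _ le dir
  (fun F x y => summability.partial_sum (fun s => K_ s x y) F)).
- move=> A B AB; rewrite !psE; apply: qf_kle; [exact: posdef_sum|exact: posdef_sum|].
  move=> s; rewrite /qf !form_sum !re_sum; apply: ler_sum_fsubset => // i.
  exact: posdef_qf_ge0.
- by move=> x y; exact: hs.
- by move=> F; rewrite psE; exact: lsc_sum.
Qed.

(** A direct sum is the unordered sum of its blocks, extended by zero; for a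
    given pair of points at most one of the terms is nonzero. *)
Lemma root_direct_sum (S : Type) (X_ : S -> set X) (K_ : forall s, ckernel R (X_ s)) K :
  posdef K -> is_direct_sum K_ K -> (has_pdms_root K <-> forall s, has_pdms_root (K_ s)).
Proof.
move=> pK [tr cov hin hout]; split=> [hK s|hs].
  suff -> : K_ s = krestrict (X_ s) K by exact: root_krestrict.
  by apply/funext => x; apply/funext => y; rewrite -hin.
pose Kt (s : {classic S}) : ckernel R X :=
  pullback (K_ s) (fun=> 1) (fun x => insub x : option (X_ s)).
apply: (@root_sum {classic S} Kt) => // [s|x y].
  have [pKs lKs] := (has_root_lsc _).1 (hs s).
  apply/has_root_lsc; split; first exact: posdef_pullback.
  apply: (@lsc_pullback _ _ _ _ _ _ 1) => //.
    by move=> z; rewrite normc1.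
  move=> z z' v; case: insubP => // v1 _ <- [->].
  by case: insubP => // v2 _ <- [->].
have [s _ xs] : (\bigcup_s X_ s) x by rewrite cov.
have <- : Kt s x y = K x y.
  rewrite /Kt /pullback rmorph1 !mul1r; case: insubP => [vx _ vxE|]; last first.
    by rewrite (mem_set xs).
  rewrite /kernel_option; case: insubP => [vy _ vyE|ys]; first by rewrite -hin vxE vyE.
  have [t _ yt] : (\bigcup_s X_ s) y by rewrite cov.
  rewrite -[x in RHS]vxE -[y in RHS](_ : val (exist _ y (mem_set yt) : X_ t) = y) //.
  rewrite hout // => st; move: ys yt; rewrite -st => /negP h1 h2; apply: h1.
  exact: mem_set.
apply/has_sumP; apply: (@is_sum_single _ _ (fun s : {classic S} => Kt s x y) s) => t ts.
rewrite /Kt /pullback; case: insubP => [vx xt _|_]; last by rewrite /= mulr0.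
case/eqP: ts; apply: (tr t s) => //; exists x; split => //; exact: set_mem.
Qed.

Lemma greatest_root_kernel K : posdef K -> exists! K0 : ckernel R X,
  [/\ posdef K0, kle K0 K, has_pdms_root K0 &
      forall L, posdef L -> kle L K -> has_pdms_root L -> kle L K0].
Proof.
move=> pK; have [a [h1 h2 h3]] := greatest_regular_part (@ebasis R X) pK.
exists (fun x y => dot (a x) (a y)).
have ha : [/\ posdef (fun x y => dot (a x) (a y)), kle (fun x y => dot (a x) (a y)) K,
    has_pdms_root (fun x y => dot (a x) (a y)) &
    forall L, posdef L -> kle L K -> has_pdms_root L -> kle L (fun x y => dot (a x) (a y))].
  split => //; first exact: posdef_gram.
    exists (fun x y => coord (a x) y); apply: (@rows_root _ _ _ _ a) => //.
    by move: h2; congr posdef; apply/funext => x; apply/funext => y; rewrite dot_ebasis.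
  move=> L pL LK /has_root_lsc[_ lL]; apply: qf_kle => // [|s]; first exact: posdef_gram.
  by rewrite qf_gram; apply: h3 => //; exact: lL.
split=> // K' [p' k' r' m']; have [p k r m] := ha.
by apply: kle_anti; [exact: m'|exact: m].
Qed.

Lemma root_equivalent K L (c1 c2 : R) : posdef K -> posdef L -> 0 < c1 -> 0 < c2 ->
  kle (kscale c1 K) L -> kle L (kscale c2 K) -> (has_pdms_root K <-> has_pdms_root L).
Proof.
move=> pK pL c10 c20 h1 h2; split=> /has_root_lsc[_ l]; apply: lsc_root => //.
  exact: (lsc_equivalent pK pL c10 c20 h1 h2 l).
have [i1 i2] : 0 < c1^-1 /\ 0 < c2^-1 by rewrite !invr_gt0.
apply: (@lsc_equivalent _ _ L K c2^-1 c1^-1) => //.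
  apply: qf_kle => // [|s]; first by apply: posdef_kscale => //; exact: ltW.
  by rewrite qf_kscale ler_pdivrMl // -qf_kscale; exact: kle_qf.
apply: qf_kle => // [|s]; first by apply: posdef_kscale => //; exact: ltW.
by rewrite qf_kscale ler_pdivlMl // -qf_kscale; exact: kle_qf.
Qed.

End Parts.

(** * Two facts from operator theory *)

Section UniformBoundedness.
Variables (R : realType) (H : hilbert R).

(** The point [l] is the limit of steps of length [rho n], taken in the direction
    of [t n] or in the opposite one; for one of the two signs the pairing with
    [t n] is at least [rho n * nrm (t n)], and all later steps together undo at
    most half of that. *)
Lemma uniform_boundedness (I : Type) (T : I -> H) :
  (forall u : H, exists C : R, forall i, normc (dot u (T i)) <= C) ->
  exists C : R, forall i, nrm (T i) <= C.
Proof.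
move=> hpt; apply: contrapT => hunb.
have big (C : R) : exists i, C < nrm (T i).
  apply: contrapT => h; apply: hunb; exists C => i; rewrite leNgt; apply/negP => lt.
  by apply: h; exists i.
pose rho n : R := 3^-1 ^+ n.
have rho0 n : 0 < rho n by rewrite exprn_gt0 // invr_gt0.
pose t n := T (projT1 (cid (big (2 * n%:R / rho n)))).
have ht n : 2 * n%:R / rho n < nrm (t n) := projT2 (cid (big (2 * n%:R / rho n))).
have t0 n : 0 < nrm (t n).
  by apply: le_lt_trans (ht n); rewrite divr_ge0 ?mulr_ge0 // ltW.
pose d n : H := (rho n / nrm (t n))%:C *: t n.
have nd n : nrm (d n) = rho n.
  rewrite nrmZ normc_real ger0_norm ?divfK ?gt_eqF //.
  by rewrite divr_ge0 // ltW.
have dt n : dot (d n) (t n) = (rho n * nrm (t n))%:C.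
  rewrite dotZl dotuuE -nrm2 -rmorphM; congr (_%:C).
  by field; rewrite gt_eqF.
pose fix x n : H := if n is k.+1 then
    if rho k * nrm (t k) <= normc (dot (x k + d k) (t k)) then x k + d k else x k - d k
  else 0.
have xt n : rho n * nrm (t n) <= normc (dot (x n.+1) (t n)).
  rewrite /=; case: ifP => // /negbT; rewrite -ltNge => h.
  have := le_normcD (dot (x n + d n) (t n)) (- dot (x n - d n) (t n)).
  have -> : dot (x n + d n) (t n) - dot (x n - d n) (t n) = (2 * (rho n * nrm (t n)))%:C.
    by rewrite dotDl dotBl dt mulr_natl mulr2n rmorphD; ring.
  rewrite normcN normc_real ger0_norm; first lra.
  by rewrite mulr_ge0 // mulr_ge0 // ltW.
have xd n k : nrm (x (n + k)%N - x n) <= 3 / 2 * (rho n - rho (n + k)%N).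
  elim: k => [|k IH]; first by rewrite addn0 !subrr nrm0 mulr0.
  apply: (le_trans (nrm_tri _ (x (n + k)%N) _)).
  have : nrm (x (n + k.+1)%N - x (n + k)%N) <= rho (n + k)%N.
    rewrite addnS /=; case: ifP => _; first by rewrite addrC addKr nd.
    by rewrite addrC addKr nrmN nd.
  have : rho (n + k.+1)%N = 3^-1 * rho (n + k)%N by rewrite addnS /rho exprS.
  lra.
have [l hl] : exists l, hcvg x l.
  apply: cauchy_hcvg => e e0.
  have [||N hN] := @nondecreasing_cauchy R (fun n => - (3 / 2 * rho n)) 0 _ _ e e0.
  - move=> n; rewrite lerN2 ler_pM2l // /rho exprS.
    have := rho0 n; rewrite /rho; lra.
  - by move=> n; rewrite oppr_le0 mulr_ge0 // ltW.
  exists N => m n; wlog mn : m n / (n <= m)%N.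
    by move=> h hm hn; have [/h|/ltnW/h] := leqP n m; [apply|rewrite nrmC; apply].
  move=> hm hn; rewrite -(subnKC mn); apply: (le_trans (xd _ _)); rewrite subnKC //.
  have := hN m n hm hn; lra.
have [C hC] := hpt l.
pose n := (Num.truncn C).+1.
have hn : C < n%:R by rewrite /n; exact: truncnS_gt.
have xl : nrm (l - x n.+1) <= 2^-1 * rho n.
  have h : hcvg (fun k => x (k + n.+1)%N - x n.+1) (l - x n.+1).
    apply: hcvgB; last exact: hcvg_cst.
    by apply: (@hcvg_sub _ _ (fun k => (k + n.+1)%N) _ _ _ hl) => k; exact: leq_addr.
  apply: (hcvg_nrm_le _ h) => k; rewrite addnC; apply: (le_trans (xd _ _)).
  have := rho0 (n.+1 + k)%N.
  have -> : rho n.+1 = 3^-1 * rho n by rewrite /rho exprS.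
  lra.
have h1 := le_normcD (dot l (t n)) (- dot (l - x n.+1) (t n)).
have h2 : dot l (t n) - dot (l - x n.+1) (t n) = dot (x n.+1) (t n).
  by rewrite dotBl; ring.
rewrite h2 normcN in h1.
have h3 := le_trans (cauchy_schwarz _ _) (ler_wpM2r (ltW (t0 n)) xl).
have h4 := xt n.
have h5 : normc (dot l (t n)) <= C by exact: hC.
have h6 : 2 * n%:R < nrm (t n) * rho n by rewrite -ltr_pdivrMr.
have h7 := mulrC (rho n) (nrm (t n)).
lra.
Qed.

End UniformBoundedness.

Section UniqueSquareRoot.
Variables (R : realType) (H : hilbert R).

(** [(1 + B) ^ j] applied to [v] grows at least like [sqrt j] unless
    [<B v, v> = 0]. *)
Lemma bounded_orbit_form0 (B : H -> H) (u : nat -> H) (C : R) :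
  selfadj B -> positive B -> (forall n, u n.+1 = u n + B (u n)) ->
  (forall n, nrm (u n) <= C) -> re (dot (B (u 0%N)) (u 0%N)) = 0.
Proof.
move=> sB pB hu hC; set b := re _.
have mon n : b <= re (dot (B (u n)) (u n)).
  elim: n => [//|n IH]; apply: (le_trans IH); rewrite hu selfadjD // !(dotDl, dotDr) !reD.
  rewrite [re (dot (B (B (u n))) (u n))]redotC -[dot (u n) _]sB.
  have := pB (B (u n)); have := dot_ge0 (B (u n)); lra.
have grow n : n%:R * (2 * b) <= nrm (u n) ^+ 2.
  elim: n => [|n IH]; first by rewrite mul0r sqr_ge0.
  rewrite hu nrm2D redotC -natr1; have := mon n; have := sqr_ge0 (nrm (B (u n))).
  lra.
apply/le_anti; rewrite [0 <= b]pB andbT leNgt; apply/negP => b0.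
pose n := (Num.truncn (C ^+ 2 / (2 * b))).+1.
have : C ^+ 2 / (2 * b) < n%:R by exact: truncnS_gt.
rewrite ltr_pdivrMr ?mulr_gt0 // => h.
have := lt_le_trans h (grow n); rewrite ltNge => /negP; apply.
by rewrite ler_pXn2r ?nnegrE ?nrm_ge0 // (le_trans (nrm_ge0 _) (hC 0%N)).
Qed.

(** [D = A - B] satisfies [D A = - B D], hence [(1 + B) ^ n D = D (1 - A) ^ n],
    which is bounded in [n].  By the previous lemma [B D = 0], likewise
    [A D = 0], and so [D ^ 2 = 0]. *)
Lemma unique_square_root (A B : H -> H) : selfadj A -> selfadj B ->
  positive A -> positive B ->
  (forall u, re (dot (A u) u) <= nrm u ^+ 2) -> (forall u, re (dot (B u) u) <= nrm u ^+ 2) ->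
  (forall u, A (A u) = B (B u)) -> A =1 B.
Proof.
have kill (T S : H -> H) v : selfadj T -> selfadj S -> positive T -> positive S ->
  (forall u, re (dot (T u) u) <= nrm u ^+ 2) -> (forall u, re (dot (S u) u) <= nrm u ^+ 2) ->
  (forall u, T (T u) = S (S u)) -> S (T v - S v) = 0.
  move=> sT sS pT pS bT bS TS.
  have cT : contraction (fun u => u - T u).
    move=> u; rewrite -(@ler_pXn2r _ 2) ?nnegrE ?nrm_ge0 // nrm2B redotC.
    by have := nrm2_le_form u sT pT bT; have := pT u; lra.
  have cc (Q : H -> H) : selfadj Q -> positive Q -> (forall u, re (dot (Q u) u) <= nrm u ^+ 2) ->
      contraction Q.
    move=> sQ pQ bQ u; rewrite -(@ler_pXn2r _ 2) ?nnegrE ?nrm_ge0 //.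
    exact: le_trans (nrm2_le_form u sQ pQ bQ) (bQ u).
  pose D u := T u - S u.
  pose x n := iter n (fun u => u - T u) v.
  have xv n : nrm (x n) <= nrm v.
    by elim: n => [//|n IH]; apply: le_trans IH; exact: cT.
  have h : re (dot (S (D v)) (D v)) = 0.
    apply: (@bounded_orbit_form0 S (fun n => D (x n)) (2 * nrm v)) => // n.
      have alg (a b c d : H) : a - b - (c - d) = a - c + (d - b).
        by rewrite opprB (addrC d) addrACA (addrC (- b)).
      by rewrite [x n.+1]/(x n - T (x n)) /D (selfadjB _ _ sT) !(selfadjB _ _ sS) TS alg.
    apply: (le_trans (nrmB _ _)); have := cc T sT pT bT (x n); have := cc S sS pS bS (x n).
    have := xv n; lra.
  apply: nrm_eq0; apply/eqP; rewrite -sqrf_eq0; apply/eqP/le_anti.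
  by rewrite sqr_ge0 andbT -h; exact: nrm2_le_form.
move=> sA sB pA pB bA bB AB u.
have h1 := kill A B u sA sB pA pB bA bB AB.
have h2 := kill B A u sB sA pB pA bB bA (fun v => esym (AB v)).
apply/subr0_eq/dot_eq0; rewrite {2}(_ : A u - B u = A u - B u) //.
rewrite dotBr -sA -sB h1 dot0l subr0.
have -> : A u - B u = - (B u - A u) by rewrite opprB.
by rewrite selfadjN // h2 oppr0 dot0l.
Qed.
End UniqueSquareRoot.

(** * Bounded kernels have unique roots *)

Section UniqueRoots.
Variables (R : realType) (X : choiceType).
Local Notation H := (l2H R X).
Local Notation eb := (@ebasis R X).
Local Notation w := (comb eb).
Implicit Types (K L M : ckernel R X) (s t h : seq (R[i] * X)).

Definition form_bounded L (c : R) := forall s, qf L s <= c * nrm (w s) ^+ 2.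

Lemma dense_seq (f : H) : exists s : nat -> seq (R[i] * X), hcvg (fun n => w (s n)) f.
Proof.
have ex n : exists s, nrm (f - w s) <= n.+1%:R^-1.
  by apply: finite_support_dense; rewrite invr_gt0.
exists (fun n => projT1 (cid (ex n))).
apply: (@hcvg_squeeze _ _ (fun n => n.+1%:R^-1)); last exact: cvg_harmonic.
by move=> n; rewrite nrmC; exact: (projT2 (cid (ex n))).
Qed.

(** The closure of [e_x |-> m x], where [m] consists of the rows of a root of
    the bounded kernel [L]. *)
Section RowOperator.
Variables (L M : ckernel R X) (m : X -> H) (c : R).
Hypotheses (c0 : 0 < c) (bL : form_bounded L c) (pM : posdef M).
Hypotheses (hm : forall x y, coord (m x) y = M x y) (hL : forall x z, dot (m x) (m z) = L x z).

Let nrm2_rows s : nrm (comb m s) ^+ 2 <= c * nrm (w s) ^+ 2.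
Proof.
have -> : nrm (comb m s) ^+ 2 = qf L s; last exact: bL.
by rewrite -qf_gram; congr qf; apply/funext => x; apply/funext => z; rewrite hL.
Qed.

Let sum_le (f : H) (F : {fset X}) :
  \sum_(x <- F) normc (dot f (m x)) ^+ 2 <= c * nrm f ^+ 2.
Proof.
pose g x := dot f (m x); set S := \sum_(x <- F) _.
pose s := [seq (g x, x) | x <- F].
have S0 : 0 <= S by apply: sumr_ge0 => x _; rewrite sqr_ge0.
have hS : S = re (dot f (comb m s)).
  rewrite /comb big_map dot_sumr re_sum; apply: eq_bigr => x _.
  by rewrite dotZr -/(g x) mulrC mul_conj.
have h1 : S <= nrm f * nrm (comb m s) by rewrite {1}hS; exact: cauchy_schwarz_re.
have h2 : nrm (comb m s) ^+ 2 <= c * S.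
  by apply: (le_trans (nrm2_rows s)); rewrite nrm2_comb_fset.
have h3 : S ^+ 2 <= nrm f ^+ 2 * (c * S).
  apply: (@le_trans _ _ ((nrm f * nrm (comb m s)) ^+ 2)).
    by rewrite ler_pXn2r ?nnegrE // mulr_ge0 ?nrm_ge0.
  by rewrite exprMn ler_wpM2l ?sqr_ge0.
have [Sle|Sgt] := leP S 0.
  by apply: (le_trans Sle); rewrite mulr_ge0 ?sqr_ge0 // ltW.
by rewrite -(ler_pM2r Sgt) -expr2 (le_trans h3) // mulrCA mulrA.
Qed.

Let sq (f : H) : sqsum (fun x => dot f (m x)).
Proof. by exists (c * nrm f ^+ 2) => F; exact: sum_le. Qed.
Definition row_op (f : H) : H := mkl2 (sq f).
Lemma coord_row_op f x : coord (row_op f) x = dot f (m x).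
Proof. by rewrite coord_mk. Qed.

Lemma row_opB f g : row_op (f - g) = row_op f - row_op g.
Proof.
apply: coord_inj => x; rewrite coord_row_op dotBl -!coord_row_op.
by rewrite -!dot_ebasis dotBl.
Qed.

Lemma row_op_comb s : row_op (w s) = comb m s.
Proof.
apply: coord_inj => x; rewrite coord_row_op -dot_ebasis.
have [e1 e2] := dot_comb_rows s [:: (1, x)] pM hm.
by rewrite !comb_pt !scale1r in e1 e2; rewrite e1 e2.
Qed.

Lemma nrm_row_op f : nrm (row_op f) <= Num.sqrt c * nrm f.
Proof.
rewrite -(@ler_pXn2r _ 2) ?nnegrE ?mulr_ge0 ?nrm_ge0 ?sqrtr_ge0 //.
rewrite nrm2 exprMn sqr_sqrtr ?(ltW c0) //.
apply: (is_sum_re_le (dot_is_sum _ _)) => F; rewrite re_sum.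
under eq_bigr do rewrite mul_conj /= coord_row_op.
exact: sum_le.
Qed.

Lemma hcvg_row_op (u : nat -> H) f : hcvg u f -> hcvg (fun n => row_op (u n)) (row_op f).
Proof.
move=> hu; apply: (@hcvg_squeeze _ _ (fun n => Num.sqrt c * nrm (u n - f))).
  by move=> n; rewrite -row_opB; exact: nrm_row_op.
by rewrite -[0](mulr0 (Num.sqrt c)); apply: cvgMl_tmp.
Qed.

Lemma selfadj_row_op : selfadj row_op.
Proof.
have h f s : dot (row_op f) (w s) = dot f (row_op (w s)).
  rewrite row_op_comb /comb !dot_sumr; apply: eq_bigr => p _.
  by rewrite !dotZr dot_ebasis coord_row_op.
move=> f g; have [s hs] := dense_seq g; apply: re_mul_ext => k.
have h1 := hcvg_dot (hcvg_cst (k *: row_op f)) hs.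
have h2 := hcvg_dot (hcvg_cst (k *: f)) (hcvg_row_op hs).
have e : (fun n => re (dot (k *: row_op f) (w (s n)))) =
         (fun n => re (dot (k *: f) (row_op (w (s n))))).
  by apply/funext => n; rewrite !dotZl h.
rewrite e in h1; have := cvg_unique _ h1 h2; rewrite !dotZl; apply.
exact: Rhausdorff.
Qed.

Lemma positive_row_op : positive row_op.
Proof.
move=> f; have [s hs] := dense_seq f.
apply: (cvgr_to_ge (hcvg_dot (hcvg_row_op hs) hs)); apply: nearW => n.
have [e1 _] := dot_comb_rows (s n) (s n) pM hm.
by rewrite row_op_comb e1; exact: posdef_qf_ge0.
Qed.

End RowOperator.

Lemma bounded_root_unique L (c : R) M N : 0 < c -> form_bounded L c ->
  is_pdms_root L M -> is_pdms_root L N -> M = N.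
Proof.
move=> c0 bL hM hN; have [_ pM _] := hM; have [_ pN _] := hN.
have [m [hm mL]] := root_rows hM; have [n [hn nL]] := root_rows hN.
pose A := row_op c0 bL mL; pose B := row_op c0 bL nL.
have sA : selfadj A by exact: (selfadj_row_op c0 bL pM hm mL).
have sB : selfadj B by exact: (selfadj_row_op c0 bL pN hn nL).
have c1 : 0 < Num.sqrt c + 1 by rewrite ltr_wpDl ?sqrtr_ge0.
pose k := (Num.sqrt c + 1)^-1; have k0 : 0 < k by rewrite invr_gt0.
have AB f g : dot (A f) (A g) = dot (B f) (B g).
  have [s hs] := dense_seq f; have [t ht] := dense_seq g; apply: re_mul_ext => a.
  have h1 := hcvg_dot (hcvgZ a (hcvg_row_op c0 bL mL hs)) (hcvg_row_op c0 bL mL ht).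
  have h2 := hcvg_dot (hcvgZ a (hcvg_row_op c0 bL nL hs)) (hcvg_row_op c0 bL nL ht).
  have e : (fun i => re (dot (a *: row_op c0 bL mL (w (s i))) (row_op c0 bL mL (w (t i))))) =
           (fun i => re (dot (a *: row_op c0 bL nL (w (s i))) (row_op c0 bL nL (w (t i))))).
    apply/funext => i; rewrite !dotZl !(row_op_comb c0 bL pM hm mL) !(row_op_comb c0 bL pN hn nL) !dot_comb.
    by congr (re (_ * form _ _ _)); apply/funext => x; apply/funext => z; rewrite mL nL.
  rewrite e in h1; have := cvg_unique _ h1 h2; rewrite !dotZl; apply.
  exact: Rhausdorff.
have le1 (T : H -> H) : (forall f, nrm (T f) <= Num.sqrt c * nrm f) ->
    forall f, re (dot (k%:C *: T f) f) <= nrm f ^+ 2.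
  move=> hT f; apply: (le_trans (cauchy_schwarz_re _ _)).
  rewrite nrmZ normc_real ger0_norm ?(ltW k0) // expr2 ler_wpM2r ?nrm_ge0 //.
  rewrite mulrC ler_pdivrMr //; apply: (le_trans (hT f)).
  by rewrite mulrC ler_wpM2l ?nrm_ge0 // lerDl.
have scaled : (fun f => k%:C *: A f) =1 (fun f => k%:C *: B f).
  apply: unique_square_root.
  - by move=> u v; rewrite dotZl dotZr sA conj_real.
  - by move=> u v; rewrite dotZl dotZr sB conj_real.
  - by move=> u; rewrite dotZl reZ mulr_ge0 ?(ltW k0) //; exact: (positive_row_op c0 bL pM hm mL).
  - by move=> u; rewrite dotZl reZ mulr_ge0 ?(ltW k0) //; exact: (positive_row_op c0 bL pN hn nL).
  - by apply: le1; exact: nrm_row_op.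
  - by apply: le1; exact: nrm_row_op.
  move=> u; rewrite (selfadjZ _ _ sA) (selfadjZ _ _ sB); do 2 congr (_ *: _).
  by apply: dot_ext => v; rewrite sA sB AB.
apply/funext => x; apply/funext => y; rewrite -hm -hn; congr coord.
have := scaled (eb x); rewrite -[eb x]scale1r -(comb_pt eb) /A /B.
rewrite (row_op_comb c0 bL pM hm mL) (row_op_comb c0 bL pN hn nL) !comb_pt !scale1r.
move=> /(congr1 (fun v => k^-1%:C *: v)).
by rewrite !scalerA -rmorphM /= mulVf ?gt_eqF // !scale1r.
Qed.

Lemma bounded_has_unique_root L (c : R) : posdef L -> 0 < c -> form_bounded L c ->
  has_unique_pdms_root L.
Proof.
move=> pL c0 bL.
have [M hM] : has_pdms_root L.
  apply: lsc_root => // s d d0.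
  have [r r0 h3] : exists2 r, 0 < r & Num.sqrt c * r * Num.sqrt (qf L s) <= d / 2.
    have n0 : 0 < Num.sqrt c * Num.sqrt (qf L s) + 1.
      by rewrite ltr_wpDl ?mulr_ge0 ?sqrtr_ge0.
    exists (d / (2 * (Num.sqrt c * Num.sqrt (qf L s) + 1))).
      by rewrite divr_gt0 ?mulr_gt0.
    rewrite [leLHS](_ : _ = d / 2 *
        (Num.sqrt c * Num.sqrt (qf L s) / (Num.sqrt c * Num.sqrt (qf L s) + 1))); last first.
      by field; rewrite gt_eqF.
    by rewrite ler_piMr ?divr_ge0 ?(ltW d0) // ler_pdivrMr // mul1r lerDl.
  exists r => //.
  move=> t ht; have h1 := form_cauchy_schwarz (sub_seq t s) s pL.
  have h2 : normc (form L (sub_seq t s) s) <= Num.sqrt c * r * Num.sqrt (qf L s).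
    rewrite -(@ler_pXn2r _ 2) ?nnegrE ?mulr_ge0 ?normc_ge0 ?sqrtr_ge0 ?(ltW r0) //.
    apply: (le_trans h1); rewrite !exprMn !sqr_sqrtr ?(ltW c0) ?posdef_qf_ge0 //.
    rewrite ler_wpM2r ?posdef_qf_ge0 //; apply: (le_trans (bL _)).
    rewrite comb_sub ler_pM2l // ler_pXn2r ?nnegrE ?nrm_ge0 //.
    exact: le_trans (nrm_ge0 _) ht.
  have h4 := posdef_qf_ge0 (sub_seq t s) pL; rewrite qf_sub // in h4.
  have h5 := le_trans (abs_re_le_normc _) (le_trans h2 h3).
  rewrite /sub_seq form_catl form_scll mulN1r reB -[re (form L s s)]/(qf L s) ler_norml in h5.
  move: h5 => /andP[]; lra.
by exists M; split => // N; exact: (bounded_root_unique c0 bL hM).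
Qed.
End UniqueRoots.

(** * Unbounded kernels do not have unique roots *)

Section UnboundedRoots.
Variables (R : realType) (X : choiceType).
Local Notation H := (l2H R X).
Local Notation eb := (@ebasis R X).
Local Notation w := (comb eb).
Implicit Types (K L M : ckernel R X) (s h : seq (R[i] * X)).

(** Enlarging the domain.  If [h |-> <xi, M h>] is unbounded, the form of [L],
    extended by [|c| ^ 2] to the combinations [g + c xi], is still closable at
    finitely supported [g]; its root restricts to a root [N] of [L] with [xi]
    in the domain, that is, [h |-> <xi, N h>] is bounded. *)
Section Extension.
Variables (L M : ckernel R X) (m : X -> H) (xi : H).
Hypotheses (pL : posdef L) (pM : posdef M).
Hypotheses (hm : forall x y, coord (m x) y = M x y) (hL : forall x z, dot (m x) (m z) = L x z).
Hypothesis unbounded : forall C : R, exists h, C * nrm (w h) < normc (dot (comb m h) xi).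

Let e (o : option X) : H := if o is Some x then eb x else xi.
Let z (o : option X) : R[i] := (o == None)%:R.
Let q : ckernel R (option X) := fun o o' =>
  pullback L (fun=> 1) id o o' + z o * (z o')^*.
Let base (t : seq (R[i] * option X)) : seq (R[i] * X) := push (fun=> 1) id t.
Let coef (t : seq (R[i] * option X)) : R[i] := \sum_(p <- t) p.1 * z p.2.
Let lift s : seq (R[i] * option X) := [seq (p.1, Some p.2) | p <- s].

Let form_rank1 (t t' : seq (R[i] * option X)) : form (fun o o' => z o * (z o')^*) t t' = coef t * (coef t')^*.
Proof.
rewrite /form /coef rmorph_sum mulr_suml; apply: eq_bigr => p _.
by rewrite mulr_sumr; apply: eq_bigr => r _; rewrite rmorphM /=; ring.
Qed.

Let qfq t : qf q t = qf L (base t) + normc (coef t) ^+ 2.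
Proof. by rewrite qf_kernelD qf_push {2}/qf form_rank1 mul_conj. Qed.

Let pq : posdef q.
Proof.
apply: posdefD; first exact: posdef_pullback.
by apply/posdefP => t; rewrite form_rank1 mul_conj ler0c sqr_ge0.
Qed.

Let comb_e t : comb e t = w (base t) + coef t *: xi.
Proof.
rewrite /comb /base /push /coef; elim: t => [|[c [x|]] t IH] /=.
- by rewrite !big_nil scale0r addr0.
- by rewrite !big_cons /= IH mulr1 /z /= mulr0 add0r addrA.
- by rewrite !big_cons /= IH /z eqxx mulr1 scalerDl addrCA.
Qed.

Let base_lift s : base (lift s) = s.
Proof. by rewrite /base /push /lift; elim: s => [//|[c x] s IH] /=; rewrite IH mulr1. Qed.
Let coef_lift s : coef (lift s) = 0.
Proof. by rewrite /coef /lift big_map big1 // => p _; rewrite /z mulr0. Qed.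
Let comb_lift (a : option X -> H) s : comb a (lift s) = comb (fun x => a (Some x)) s.
Proof. by rewrite /comb /lift big_map. Qed.

(** The kernel of an unbounded functional is dense. *)
Let near_kernel s (d : R) : 0 < d ->
  exists h, dot (comb m h) xi = 0 /\ nrm (comb m s - w h) <= d.
Proof.
move=> d0; have d2 : 0 < d / 2 by rewrite divr_gt0.
have [h0 hh0] := finite_support_dense (comb m s) d2.
set b := dot (comb m h0) xi.
have [k hk] := unbounded (normc b / (d / 2)).
set g := dot (comb m k) xi in hk.
have g0 : 0 < normc g.
  by apply: le_lt_trans hk; rewrite mulr_ge0 ?nrm_ge0 // divr_ge0 ?normc_ge0 // ltW.
have gn : g != 0 by rewrite -normc_eq0 gt_eqF.
exists (sub_seq h0 (scl (b / g) k)); split.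
  by rewrite comb_sub comb_scl dotBl dotZl -/b -/g divfK // subrr.
rewrite comb_sub comb_scl opprB addrCA addrC.
apply: (le_trans (nrmD _ _)); rewrite nrmZ normcM normcV.
suff : normc b / normc g * nrm (w k) <= d / 2 by lra.
rewrite mulrAC ltr_pdivrMr // in hk.
by rewrite mulrAC ler_pdivrMr // [leRHS]mulrC ltW.
Qed.

Let lsc_at_lift s (d : R) : 0 < d -> exists2 r : R, 0 < r &
  forall t, nrm (comb e t - comb e (lift s)) <= r -> qf q (lift s) <= qf q t + d.
Proof.
move=> d0; have [|h [hxi hh]] := @near_kernel s (Num.sqrt (d / 2)).
  by rewrite sqrtr_gt0 divr_gt0.
have hh2 : nrm (comb m s - w h) ^+ 2 <= d / 2.
  rewrite -[leRHS]sqr_sqrtr ?ler_pXn2r ?nnegrE ?nrm_ge0 ?sqrtr_ge0 //.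
  by rewrite divr_ge0 // ltW.
exists (d / (4 * (nrm (comb m h) + 1))).
  by rewrite divr_gt0 // mulr_gt0 // ltr_wpDl ?nrm_ge0.
move=> t; rewrite !comb_e base_lift coef_lift scale0r addr0 => ht.
rewrite !qfq base_lift coef_lift normc0 expr0n addr0.
have k := root_lower_bound s (base t) h pM hm hL.
have xi0 : dot xi (comb m h) = 0 by rewrite dotC hxi rmorph0.
have e1 : dot (w (base t) - w s) (comb m h) = dot (w (base t) + coef t *: xi - w s) (comb m h).
  by rewrite !dotBl dotDl dotZl xi0 mulr0 addr0.
rewrite e1 in k.
have k2 := abs_re_dot_small d0 (ltr0Sn R 3) ht.
have := sqr_ge0 (normc (coef t)).
move: k2; rewrite ler_norml => /andP[k2 k3]; lra.
Qed.

Lemma extended_root : exists2 N, is_pdms_root L N & N <> M.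
Proof.
have [a [h1 h2 h3]] := greatest_regular_part e pq.
pose n x := a (Some x).
have nL x y : dot (n x) (n y) = L x y.
  have : (fun x y => dot (n x) (n y)) = L; last by move=> <-.
  have pn : posdef (fun x y => dot (n x) (n y)) by exact: posdef_gram.
  apply: kle_anti; apply: qf_kle => // s; rewrite qf_gram -comb_lift.
    have := kle_qf (lift s) h1; rewrite qf_gram qfq base_lift coef_lift.
    by rewrite normc0 expr0n addr0.
  have := h3 q (lift s) (qf_kle pq pq (fun=> lexx _)) (@lsc_at_lift s).
  by rewrite qfq base_lift coef_lift normc0 expr0n addr0.
pose N x y := coord (n x) y.
have pN : posdef N.
  move=> k x l k0; have := h2 k (fun i => Some (x i)) l k0.
  by under eq_bigr do under eq_bigr do rewrite [e _]/(eb _) dot_ebasis.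
have rN : is_pdms_root L N by exact: (@rows_root _ _ L N n).
exists N => // NM.
have nm x : n x = m x by apply: coord_inj => y; rewrite hm -NM.
have [h] := unbounded (nrm (a None)); rewrite ltNge => /negP; apply.
have -> : dot (comb m h) xi = (dot (a None) (w h))^*.
  have -> : comb m h = comb a (lift h).
    by rewrite comb_lift; congr comb; apply/funext => x; rewrite -nm.
  have -> : xi = comb e [:: (1, None)] by rewrite comb_pt scale1r.
  have -> : w h = comb e (lift h) by rewrite comb_lift.
  have -> : a None = comb a [:: (1, None)] by rewrite comb_pt scale1r.
  by rewrite !dot_comb; exact: form_conj.
by rewrite normc_conj; exact: cauchy_schwarz.
Qed.
End Extension.

(** If every functional [h |-> <xi, M h>] is bounded then so is [M], by the
    uniform boundedness principle. *)
Lemma unique_root_bounded L : has_unique_pdms_root L ->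
  exists2 c : R, 0 < c & form_bounded L c.
Proof.
move=> [M [hM uM]]; have [pL pM _] := hM; have [m [hm hL]] := root_rows hM.
have qL s : qf L s = nrm (comb m s) ^+ 2.
  by rewrite -qf_gram; congr qf; apply/funext => x; apply/funext => z; rewrite hL.
have hpt (xi : H) : exists C : R, forall h, normc (dot (comb m h) xi) <= C * nrm (w h).
  apply: contrapT => hn.
  have [|N rN NM] := @extended_root L M m xi pL pM hm hL.
    move=> C; apply: contrapT => hC; apply: hn; exists C => h; rewrite leNgt; apply/negP => lt.
    by apply: hC; exists h.
  by apply: NM; apply/esym/uM.
have [|C hC] := @uniform_boundedness R H _ (fun h => (nrm (w h))^-1%:C *: comb m h).
  move=> xi; have [C hC] := hpt xi; exists `|C| => h.
  rewrite dotZr conj_real normcM normc_real ger0_norm ?invr_ge0 ?nrm_ge0 // dotC normc_conj.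
  have [->|h0] := eqVneq (nrm (w h)) 0; first by rewrite invr0 mul0r.
  rewrite ler_pdivrMl ?lt_def ?h0 ?nrm_ge0 // mulrC; apply: (le_trans (hC h)).
  by rewrite ler_wpM2r ?nrm_ge0 // ler_norm.
exists (`|C| ^+ 2 + 1); first by rewrite ltr_wpDl ?sqr_ge0.
move=> s; rewrite qL.
have : nrm (comb m s) <= `|C| * nrm (w s).
  have [h0|h0] := eqVneq (nrm (w s)) 0.
    have [C' hC'] := hpt (comb m s); have := hC' s.
    rewrite h0 !mulr0 dotuuE normc_real -nrm2 => h.
    suff -> : nrm (comb m s) = 0 by [].
    by apply/eqP; rewrite -sqrf_eq0 -normr_eq0; apply/eqP/le_anti; rewrite h normr_ge0.
  have := hC s; rewrite nrmZ normc_real ger0_norm ?invr_ge0 ?nrm_ge0 //.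
  rewrite ler_pdivrMl ?lt_def ?h0 ?nrm_ge0 // mulrC => h; apply: (le_trans h).
  by rewrite ler_wpM2r ?nrm_ge0 // ler_norm.
rewrite -(@ler_pXn2r _ 2) ?nnegrE ?mulr_ge0 ?nrm_ge0 // exprMn => h.
by apply: (le_trans h); rewrite ler_wpM2r ?sqr_ge0 // lerDl.
Qed.

(** A root is unique exactly when the kernel is bounded, so [K1] must dominate
    up to a factor whatever is dominated both by [K] and by the identity kernel.
    Their parallel sum does, because [L s <= 2 L t + 2 L (s - t)]. *)
Lemma greatest_unique_root_kernel K : posdef K -> exists K1 : ckernel R X,
  [/\ posdef K1, kle K1 K, has_unique_pdms_root K1 &
   forall L, posdef L -> (exists2 a : R, 0 < a & kle L (kscale a K)) ->
     (has_unique_pdms_root L <-> exists2 b : R, 0 < b & kle L (kscale b K1))].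
Proof.
move=> pK; have [P [pP PK Pe Pinf]] := parallel_sum eb pK.
have Pw s : qf P s <= nrm (w s) ^+ 2 by rewrite -qf_gram; exact: kle_qf.
exists P; split => //.
  by apply: (@bounded_has_unique_root _ _ P 1) => // s; rewrite mul1r.
move=> L pL [a a0 La]; split=> [/unique_root_bounded[c c0 bL]|[b b0 Lb]]; last first.
  apply: (@bounded_has_unique_root _ _ L b) => // s.
  by apply: (le_trans (kle_qf s Lb)); rewrite qf_kscale ler_pM2l.
pose b := 2 * (a + c); have b0 : 0 < b by rewrite mulr_gt0 // addr_gt0.
exists b => //; apply: qf_kle => // [|s]; first by apply: posdef_kscale => //; exact: ltW.
rewrite qf_kscale; apply/ler_addgt0Pr => d d0.
have [|t ht] := Pinf s (d / b); first by rewrite divr_gt0.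
have h1 : qf L s <= 2 * qf L t + 2 * qf L (sub_seq s t).
  have := posdef_qf_ge0 (sub_seq (sub_seq s t) t) pL.
  rewrite qf_sub // [qf L (sub_seq s t)]qf_sub //.
  by rewrite /sub_seq form_catl form_scll mulN1r reB -[re (form L t t)]/(qf L t); lra.
have h2 := kle_qf t La; rewrite qf_kscale in h2.
have h3 := bL (sub_seq s t); rewrite comb_sub in h3.
have h4 : b * (qf K t + nrm (w s - w t) ^+ 2) <= b * qf P s + d.
  have -> : b * qf P s + d = b * (qf P s + d / b) by field; rewrite gt_eqF.
  by rewrite ler_pM2l.
have h5 : 0 <= c * qf K t by rewrite mulr_ge0 ?posdef_qf_ge0 // ltW.
have h6 : 0 <= a * nrm (w s - w t) ^+ 2 by rewrite mulr_ge0 ?sqr_ge0 // ltW.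
move: h4; rewrite /b; lra.
Qed.
End UnboundedRoots.

(** * The theorem *)

Theorem theorem5p8 (R : realType) (X : choiceType) (K : ckernel R X) :
  inhabited X -> posdef K ->
  (* I *)
  (forall A : set X, A !=set0 ->
     has_pdms_root K -> has_pdms_root (krestrict A K)) /\
  (* II *)
  (forall (S : Type) (X_ : S -> set X) (K_ : forall s, ckernel R (X_ s)),
     is_direct_sum K_ K ->
     (has_pdms_root K <-> forall s, has_pdms_root (K_ s))) /\
  (* III *)
  (has_pdms_root K ->
     (forall u : X -> R[i], (exists c : R, forall x, `|u x| <= c%:C) ->
        has_pdms_root (fun x y => (u x)^* * u y * K x y)) /\
     has_pdms_root (kbd K)) /\
  (* IV *)
  (kbounded K -> has_pdms_root K ->
     forall (x : X) (e : R), 0 < e ->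
       exists2 F : set X, finite_set F & forall y, ~ F y -> `|K x y| < e%:C) /\
  (* V *)
  ((l2_kernel K -> has_pdms_root K) /\
   (forall L M : ckernel R X, is_pdms_root L M -> has_pdms_root M)) /\
  (* VI *)
  (forall (S : choiceType) (K_ : S -> ckernel R X),
     (forall s, posdef (K_ s)) -> (forall s, has_pdms_root (K_ s)) ->
     (forall x y, has_sum (fun s => K_ s x y) (K x y)) ->
     has_pdms_root K) /\
  (* VII *)
  (forall (Sigma : Type) (le : Sigma -> Sigma -> Prop)
     (K_ : Sigma -> ckernel R X),
     directed le ->
     (forall s, posdef (K_ s)) -> (forall s t, le s t -> kle (K_ s) (K_ t)) ->
     kernel_net_cvg le K_ K ->
     (forall s, has_pdms_root (K_ s)) ->
     has_pdms_root K) /\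
  (* VIII *)
  (forall L : ckernel R X, posdef L ->
     (exists c1 c2 : R,
        [/\ 0 < c1, 0 < c2, kle (kscale c1 K) L & kle L (kscale c2 K)]) ->
     (has_pdms_root K <-> has_pdms_root L)) /\
  (* IX *)
  (exists! K0 : ckernel R X,
     [/\ posdef K0, kle K0 K, has_pdms_root K0 &
         forall L, posdef L -> kle L K -> has_pdms_root L -> kle L K0]) /\
  (* X *)
  (exists K1 : ckernel R X,
     [/\ posdef K1, kle K1 K, has_unique_pdms_root K1 &
         forall L, posdef L -> (exists2 a : R, 0 < a & kle L (kscale a K)) ->
           (has_unique_pdms_root L <->
            exists2 b : R, 0 < b & kle L (kscale b K1))]).
Proof.
move=> _ pK; split; last split; last split; last split; last split; last split;
  last split; last split; last split.
- by move=> A _; exact: root_krestrict.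
- by move=> S X_ K_; exact: root_direct_sum.
- move=> hK; split; last exact: root_kbd.
  by move=> u [c hc]; exact: root_multiplier hc hK.
- exact: root_c0.
- by split; [exact: root_l2_kernel|exact: root_of_root].
- by move=> S K_ _; exact: root_sum.
- move=> Sigma le K_ dir _ mon cvg hs; apply: lsc_root => //.
  apply: (lsc_increasing_net dir mon cvg) => s.
  by have [] := (has_root_lsc _).1 (hs s).
- move=> L pL [c1 [c2 [c10 c20 h1 h2]]]; exact: root_equivalent pK pL c10 c20 h1 h2.
- exact: greatest_root_kernel.
- exact: greatest_unique_root_kernel.
Qed.
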